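(* Let $f(x)=(x^k+c)^m-ax^n\in\mathbb{Z}[x]$ ($a,c\in\mathbb{Z}$, $k,m,n\in\mathbb{N}$, $km>n$) be irreducible over $\mathbb{Q}$, of degree $d=km$. Assume: (1) $q=km-n$ is a prime with $d/2<q<d-2$; (2) there is a prime $p$ with $p\mid c$, $p\mid a$, $p^2\nmid a$; (3) $k(m-1)$ is odd; (4) there is a prime $\ell$ with $v_\ell(a)$ odd and $\ell\nmid kmc$. Then the Galois group of $f(x)$ over $\mathbb{Q}$ is the symmetric group $S_d$.
   Context: $v_\ell$ denotes the $\ell$-adic valuation. *)

(* Defs.v *)
From HB Require Import structures.
From mathcomp Require Import all_boot all_order all_algebra all_fingroup all_field.
Set Implicit Arguments. Unset Strict Implicit. Unset Printing Implicit Defensive.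
Import GRing.Theory Num.Theory.
Local Open Scope ring_scope.

Definition fpoly (a c : int) (k m n : nat) : {poly rat} :=
  ('X^k + (c%:~R)%:P) ^+ m - (a%:~R)%:P * 'X^n.

(* Main.v *)
Require Import Defs.
From HB Require Import structures.
From mathcomp Require Import all_boot all_order all_algebra all_fingroup all_field.
From mathcomp Require Import all_solvable zify ring lra.
From mathcomp Require boolp classical_sets.
Set Implicit Arguments. Unset Strict Implicit. Unset Printing Implicit Defensive.
Import Order.TTheory GRing.Theory Num.Theory.
Local Open Scope ring_scope.

(**
The Galois group G acts on the d = k m roots, transitively since f is
irreducible. Let q = k m - n.

Order divisible by q. Extend the p-adic valuation to w on the splitting field.
From (z^k + c)^m = a z^n one reads off that a root z has w(z) = 1/q if
k w(z) < w(c), and that w(z) has a denominator dividing n k otherwise. As the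
product of the roots is +-c^m, the number of roots of the first kind is
divisible by q and positive, hence equal to q. By parity n + 1 < q, so every set
of n + 1 roots contains between 1 and q - 1 roots of the first kind, and every
conjugate of the product y of n + 1 roots has a valuation whose denominator is
divisible by q. So all the slopes of the Newton polygon of the product of the
X - s(y), s in G, have a denominator divisible by q; since its vertices are
integral, its width #|G| is divisible by q.

Odd permutation. For the l-adic valuation, all roots are units and
w(f'(z)) = (m - 1) v_l(a) / m, so that the discriminant has the odd valuation
k (m - 1) v_l(a) and is not a square.

Group theory. G contains a q-cycle g with q > d/2. Stabilisers of sets of fixed
points of g are transitive on the remaining points, so by a Frattini argument
the normaliser of <g> induces all transpositions of the fixed points of g. A
commutator of two of these, raised to the power q, is a 3-cycle of G; its
conjugates generate the alternating group.
*)

(** * Transitive groups containing a long cycle of prime length *)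

Local Open Scope nat_scope.
Local Open Scope group_scope.

Section PrimeCycle.

Variables (T : finType) (q : nat) (g : {perm T}).
Hypothesis q_pr : prime q.
Let D : {set T} := ~: 'Fix_'P[g].
Hypothesis g_trans : [transitive <[g]>, on D | 'P].
Hypothesis cardD : #|D| = q.
Hypothesis ord_g : #[g] = q.

Let q_gt0 : 0 < q. Proof. exact: prime_gt0. Qed.

(** Take the block through a point of [D]; its orbit under [<[g]>] has 1 or [q] members. In the
    first case it contains [D], and two blocks of size at least [q] overfill [A]; in the second
    there are at least [q] blocks of size at least 2. *)
Lemma prime_cycle_primitive (K : {group {perm T}}) (A : {set T}) :
  g \in K -> D \subset A -> #|A| < 2 * q ->
  [transitive K, on A | 'P] -> [primitive K, on A | 'P].
Proof.
move=> Kg sDA ltA2q trK; rewrite /primitive trK negb_exists; apply/forallP=> P.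
apply/negP=> /and3P[partP actP /andP[gt1P ltPA]].
have [/eqP covP tiP n0P] := and3P partP.
have acts X h : h \in K -> X \in P -> setact 'P X h \in P.
  by move=> Kh; rewrite (acts_act actP Kh).
have eqcard : {in P &, forall X Y : {set T}, #|X| = #|Y|}.
  move=> X Y PX PY.
  have [x Xx] : exists x, x \in X by apply/set0Pn; apply: contraNneq n0P => <-.
  have [y Yy] : exists y, y \in Y by apply/set0Pn; apply: contraNneq n0P => <-.
  have Ax : x \in A by rewrite -covP; apply/bigcupP; exists X.
  have Ay : y \in A by rewrite -covP; apply/bigcupP; exists Y.
  have [h Kh yE] := atransP2 trK Ax Ay.
  suff -> : Y = setact 'P X h by rewrite card_setact.
  rewrite -(def_pblock tiP PY Yy) -(def_pblock tiP (acts X h Kh PX) (x := y)) //.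
  by rewrite yE mem_setact.
have [x0 Dx0] : exists x, x \in D.
  by apply/set0Pn; rewrite -card_gt0 cardD.
pose X := pblock P x0.
have cx0 : x0 \in cover P by rewrite covP (subsetP sDA).
have PX : X \in P by rewrite pblock_mem.
have Xx0 : x0 \in X by rewrite mem_pblock.
have cardA : #|A| = (#|P| * #|X|)%N.
  by apply: card_uniform_partition partP => Y PY; apply: eqcard.
have X_gt0 : 0 < #|X| by apply/card_gt0P; exists x0.
have sgK : <[g]> \subset K by rewrite cycle_subG.
have := dvdn_orbit ('P^*)%act <[g]> X; rewrite -/(#[g]) ord_g.
case/(primeP q_pr).2/orP => /eqP cX.
  have DX : D \subset X.
    rewrite -(atransP g_trans _ Dx0); apply/subsetP=> _ /orbitP[h gh <-].
    have fX := card_orbit1 cX.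
    have : setact 'P X h \in orbit ('P^*)%act <[g]> X by rewrite mem_orbit.
    by rewrite fX inE => /eqP <-; rewrite mem_setact.
  have := subset_leq_card DX; rewrite cardD => leqX.
  have : 2 * q <= #|A| by rewrite cardA leq_mul.
  by rewrite leqNgt ltA2q.
have leqP : q <= #|P|.
  rewrite -cX; apply/subset_leq_card/subsetP=> _ /orbitP[h gh <-].
  by rewrite acts // (subsetP sgK).
have le2X : 2 <= #|X|.
  by rewrite ltnNge; apply/negP=> leX1; move: ltPA; rewrite cardA ltnNge -{2}[#|P|]muln1 leq_mul.
by move: ltA2q; rewrite cardA ltnNge mulnC leq_mul.
Qed.

(* The complement in A of the K_x-orbit of D generates, via the subgroup H of
   elements moving x into it, a block that avoids D. *)
Lemma prime_cycle_stab_trans (K : {group {perm T}}) (A : {set T}) x :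
  g \in K -> D \subset A -> #|A| < 2 * q -> [transitive K, on A | 'P] ->
  x \in A -> x \notin D -> [transitive 'C_K[x | 'P], on A :\ x | 'P].
Proof.
move=> Kg sDA ltA2q trK Ax nDx.
have sgK : <[g]> \subset K by rewrite cycle_subG.
have actK := acts_act (atrans_acts trK).
have [d Dd] : exists x, x \in D by apply/set0Pn; rewrite -card_gt0 cardD.
have fixg y : y \notin D -> g \in 'C[y | 'P].
  by rewrite inE negbK => /afix1P gy; apply/astab1P.
have sgC y : y \notin D -> <[g]> \subset 'C_K[y | 'P].
  by move=> nDy; rewrite cycle_subG inE Kg fixg.
pose O y := orbit 'P 'C_K[y | 'P] d.
have sDO y : y \notin D -> D \subset O y.
  by move=> nDy; rewrite -(atransP g_trans _ Dd) imsetS ?sgC.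
have sOA y : O y \subset A.
  apply/subsetP=> _ /orbitP[h /setIP[Kh _] <-].
  by rewrite actK // (subsetP sDA).
have memO y : y \notin D -> y \notin O y.
  move=> nDy; apply/negP=> /orbitP[h /setIP[_ /astab1P hy] yE].
  have /(@act_inj _ _ _ 'P) dy : 'P%act d h = 'P%act y h by rewrite yE hy.
  by rewrite -dy Dd in nDy.
(* Both sides are orbits of the stabiliser of [aperm x u] with at least [q] points each. As
   [#|A| < 2 * q], they meet and hence coincide. *)
have OE u : u \in K -> aperm x u \notin D -> setact 'P (O x) u = O (aperm x u).
  move=> Ku nDxu.
  have E1 : setact 'P (O x) u = orbit 'P 'C_K[aperm x u | 'P] (aperm d u).
    rewrite /O; have /= -> := setact_orbit 'P 'C_K[x | 'P] d u.
    by rewrite conjIg conjGid // -astab1_act.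
  have [z /setIP[]] : exists z, z \in setact 'P (O x) u :&: O (aperm x u).
    apply/set0Pn; apply: contraL ltA2q => /eqP I0; rewrite -leqNgt.
    have sA : setact 'P (O x) u :|: O (aperm x u) \subset A.
      rewrite subUset sOA andbT; apply/subsetP=> _ /imsetP[z Oz ->].
      by rewrite actK // (subsetP (sOA x)).
    have := subset_leq_card sA; rewrite cardsU I0 cards0 subn0; apply: leq_trans.
    rewrite mul2n -addnn leq_add // -cardD; last by rewrite subset_leq_card ?sDO.
    by rewrite card_setact subset_leq_card ?sDO.
  by rewrite E1 => /orbit_eqP <- /orbit_eqP ->.
pose M := [set h in K | aperm x h \in A :\: O x].
have sMK : <<M>> \subset K by rewrite gen_subG; apply/subsetP=> h /setIdP[].
(* Induction on words: if [h] in [M] is followed by [u] and [x] lands in [D], it lands in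
   [O (aperm x u)], the image of [O x] under [u]. So [aperm x h] is in [O x], against the choice of
   [M]. *)
have MD h : h \in <<M>> -> aperm x h \notin D.
  case/gen_prodgP=> n [c Mc ->]; elim: n c Mc => [|n IHn] c Mc.
    by rewrite big_ord0 [aperm x 1]act1.
  rewrite big_ord_recl; set u := \prod_(i < n) _.
  have nDu : aperm x u \notin D by apply: IHn.
  have Ku : u \in K.
    by apply: group_prod => i _; have /setIdP[] := Mc (lift ord0 i).
  have /setIdP[Kh /setDP[Axh nOxh]] := Mc ord0.
  apply: contra nOxh => Dxhu.
  have : aperm x (c ord0 * u) \in setact 'P (O x) u.
    by rewrite OE // (subsetP (sDO _ nDu)).
  rewrite [aperm x (_ * _)]actM => /imsetP[z Oz].
  by move/(@act_inj _ _ _ 'P) ->.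
(* Primitivity makes the stabiliser of [x] maximal, so [<<M>>] is this stabiliser or [K]. It is not
   [K], which moves [x] into [D]. Hence [M] fixes [x], and [x] is the only point of [A] outside
   [O x]. *)
have prK := prime_cycle_primitive Kg sDA ltA2q trK.
rewrite (trans_prim_astab Ax trK) in prK.
have [_ maxC] := maximal_eqP _ _ prK.
have sCM : 'C_K[x | 'P] \subset <<M>>.
  apply/subsetP=> h /setIP[Kh /astab1P hx]; apply: mem_gen.
  by rewrite inE Kh [aperm x h]hx inE memO.
have [HC|HK] := maxC _ sCM sMK; last first.
  have [h Kh dE] := atransP2 trK Ax (subsetP sDA _ Dd).
  by move: (MD h); rewrite [<<M>>]HK -[aperm x h]dE Dd => /(_ Kh).
have -> : A :\ x = O x; last exact: atrans_orbit.
apply/setP=> z; apply/setD1P/idP=> [[nzx Az]|Oz]; last first.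
  split; last exact: (subsetP (sOA x)).
  by apply: contraNneq (memO x nDx) => zx; rewrite -{1}zx.
apply: contraR nzx => nOz.
have [h Kh zE] := atransP2 trK Ax Az.
have : h \in <<M>>.
  by apply: mem_gen; rewrite inE Kh -[aperm x h]zE inE nOz.
by rewrite [<<M>>]HC => /setIP[_ /astab1P]; rewrite -zE => ->.
Qed.

Variable G : {group {perm T}}.
Hypothesis trG : [transitive G, on setT | 'P].
Hypothesis Gg : g \in G.
Hypothesis ltT2q : #|T| < 2 * q.

Let sg : <[g]> \subset G. Proof. by rewrite cycle_subG. Qed.

Let DE x : (x \in D) = (g x != x).
Proof. by rewrite inE; congr (~~ _); apply/afix1P/eqP. Qed.

Let FE x : (x \in 'Fix_'P[g]) = (x \notin D).
Proof. by rewrite [in RHS]inE negbK. Qed.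

(** Points are fixed one at a time: the stabiliser of the earlier ones still contains [g], and the
    remaining points still include [D], so [prime_cycle_stab_trans] applies again. *)
Lemma prime_cycle_astab_trans (S : {set T}) :
  S \subset 'Fix_'P[g] -> [transitive 'C_G(S | 'P), on ~: S | 'P].
Proof.
have [n] := ubnP #|S|; elim: n S => // n IHn S ltSn sSF.
have [->|[x Sx]] := set_0Vmem S.
  rewrite setC0 (_ : 'C_G(_ | _) = G) //; apply/setIidPl/subsetP=> h _.
  by apply/astabP=> x; rewrite inE.
have sS'S : S :\ x \subset S by apply: subsetDl.
have trS' : [transitive 'C_G(S :\ x | 'P), on ~: (S :\ x) | 'P].
  apply: IHn; last exact: subset_trans sSF.
  by rewrite (cardsD1 x) Sx in ltSn.
have -> : 'C_G(S | 'P) = 'C_('C_G(S :\ x | 'P))[x | 'P].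
  by rewrite -setIA -astabU setUC setD1K.
have -> : ~: S = ~: (S :\ x) :\ x.
  by apply/setP=> z; rewrite !inE negb_and negbK; case: eqVneq => [->|]; rewrite ?Sx.
apply: prime_cycle_stab_trans => //.
- rewrite inE Gg; apply/astabP=> z S'z.
  by apply/afix1P; apply: (subsetP sSF); apply: (subsetP sS'S).
- by rewrite setCS (subset_trans sS'S).
- by apply: leq_ltn_trans ltT2q; apply: max_card.
- by rewrite !inE eqxx.
- by rewrite -FE (subsetP sSF).
Qed.

(** [h1] moves [x] to [y] and fixes the other fixed points of [g], so it sends [y] to [x] or into
    [D]. From there [h2] leads to [x] while fixing every fixed point of [g] except [x]. *)
Lemma prime_cycle_swap x y :
  x \notin D -> y \notin D -> x != y ->
  exists u, [/\ u \in G, u x = y, u y = x &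
    forall z, z \notin D -> z != x -> z != y -> u z = z].
Proof.
move=> nDx nDy nxy.
pose S := 'Fix_'P[g] :\ y.
have trSx : [transitive 'C_G(S :\ x | 'P), on ~: (S :\ x) | 'P].
  by apply: prime_cycle_astab_trans; rewrite !subDset subsetU // subsetUr orbT.
have trS : [transitive 'C_G('Fix_'P[g] :\ x | 'P), on ~: ('Fix_'P[g] :\ x) | 'P].
  by apply: prime_cycle_astab_trans; rewrite subDset subsetUr.
have [h1 /setIP[Gh1 /astabP fh1] yE] : exists2 h, h \in 'C_G(S :\ x | 'P) & y = aperm x h.
  by apply: (atransP2 trSx); rewrite !inE ?eqxx ?andbF.
have nyy1 : aperm y h1 != y.
  by apply: contra nxy => /eqP; rewrite {2}yE => /(@act_inj _ _ _ 'P) ->.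
have [h2 /setIP[Gh2 /astabP fh2] xE] :
    exists2 h, h \in 'C_G('Fix_'P[g] :\ x | 'P) & x = aperm (aperm y h1) h.
  apply: (atransP2 trS); rewrite in_setC in_setD1 ?eqxx //.
  apply/negP=> /andP[nx1 F1]; apply: (negP nyy1); apply/eqP.
  have /fh1 : aperm y h1 \in S :\ x by rewrite !in_setD1 nx1 nyy1.
  by move/(@act_inj _ _ _ 'P).
exists (h1 * h2); split.
- by rewrite groupM.
- rewrite permM -[h1 x]yE; apply: fh2.
  by rewrite in_setD1 eq_sym nxy FE.
- by rewrite permM.
- move=> z nDz nzx nzy; rewrite permM.
  have -> : h1 z = z by apply: fh1; rewrite !in_setD1 nzx nzy FE.
  by apply: fh2; rewrite in_setD1 nzx FE.
Qed.

(** As [q <= #|T| < 2 * q], the prime [q] divides the factorial of [#|T|] exactly once. *)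
Lemma prime_cycle_Sylow : q.-Sylow('C_G('Fix_'P[g] | 'P)) <[g]>.
Proof.
have gC : g \in 'C_G('Fix_'P[g] | 'P).
  by rewrite inE Gg; apply/astabP=> z /afix1P.
rewrite pHallE cycle_subG gC /= -/(#[g]) ord_g p_part.
suff -> : logn q #|'C_G('Fix_'P[g] | 'P)| = 1%N by [].
apply/eqP; rewrite eqn_leq; apply/andP; split; last first.
  rewrite -pfactor_dvdn ?cardG_gt0 // expn1 -{1}ord_g.
  by apply: order_dvdG.
have : #|'C_G('Fix_'P[g] | 'P)| %| #|T|`!.
  by rewrite -card_Sym; apply: cardSg; apply/subsetP => ?; rewrite inE.
move/(dvdn_leq_log q (fact_gt0 _)) => /leq_trans; apply.
have leqT : q <= #|T| by rewrite -cardD max_card.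
rewrite logn_fact // big_ltn; last by rewrite ltnS (leq_trans _ leqT).
rewrite big1_seq ?addn0 => [|i /andP[_]].
  by rewrite expn1 -ltnS ltn_divLR // mulnC.
rewrite mem_index_iota => /andP[lt1i _]; rewrite divn_small //.
apply: leq_trans ltT2q _; case: i lt1i => [|[|i]] // _.
rewrite expnS mulnC leq_mul // (leq_trans (prime_gt1 q_pr)) //.
by rewrite -{1}[q]expn1 leq_pexp2l.
Qed.

(** Frattini argument: a swap [u] preserves the fixed points of [g], so [<[g]> :^ u] is another
    Sylow subgroup of their pointwise stabiliser. An element [v] of that stabiliser corrects [u]
    without changing its action on these points. *)
Lemma prime_cycle_norm_swap x y :
  x \notin D -> y \notin D -> x != y ->
  exists h, [/\ h \in G, h \in 'N(<[g]>), h x = y, h y = x &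
    forall z, z \notin D -> z != x -> z != y -> h z = z].
Proof.
move=> nDx nDy nxy.
have [u [Gu ux uy uz]] := prime_cycle_swap nDx nDy nxy.
have uF z : z \notin D -> u z \notin D.
  move=> nDz; have [->|nzx] := eqVneq z x; first by rewrite ux.
  by have [->|nzy] := eqVneq z y; rewrite ?uy // uz.
have uF' z : z \notin D -> u^-1 z \notin D.
  move=> nDz; have [->|nzx] := eqVneq z x; first by rewrite -uy permK.
  have [->|nzy] := eqVneq z y; first by rewrite -ux permK.
  by rewrite -[z in u^-1 z](uz z) // permK.
have [v /setIP[Gv /astabP fv] uv] :
    exists2 v, v \in 'C_G('Fix_'P[g] | 'P) & <[g]> :^ u = <[g]> :^ v.
  have sub : (<[g]> :^ u)%G \subset 'C_G('Fix_'P[g] | 'P).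
    rewrite /= -cycleJ cycle_subG inE groupJ //=; apply/astabP=> z.
    rewrite FE => /uF' nDz; have /afix1P gz : u^-1 z \in 'Fix_'P[g] by rewrite FE.
    by rewrite -[LHS]/((g ^ u) z) -{1}(permKV u z) permJ [g _]gz permKV.
  have syl : q.-Sylow('C_G('Fix_'P[g] | 'P)) (<[g]> :^ u)%G.
    by rewrite pHallE sub cardJg (card_Hall prime_cycle_Sylow) eqxx.
  have [v Cv E] := Sylow_trans prime_cycle_Sylow syl.
  by exists v => //; rewrite -(congr_group E).
exists (u * v^-1).
have fv' z : z \notin D -> v^-1 z = z.
  by move=> nDz; apply/(@perm_inj _ v); rewrite permKV; apply/esym/fv; rewrite FE.
split.
- by rewrite groupM ?groupV.
- by apply/normP; rewrite conjsgM uv conjsgK.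
- by rewrite permM ux fv'.
- by rewrite permM uy fv'.
- by move=> z nDz nzx nzy; rewrite permM uz ?fv'.
Qed.

(* On D the centraliser of the cycle g acts through <[g]>, so q-th powers of
   its elements are supported on the fixed points of g. *)
Lemma prime_cycle_cent_expq z d : z \in 'C[g] -> d \in D -> (z ^+ q) d = d.
Proof.
move=> /cent1P czg Dd.
have zD : z d \in D.
  by rewrite DE -!permM czg permM (inj_eq perm_inj) -DE.
have [h /cycleP[i ->] zE] := atransP2 g_trans Dd zD.
have cz : commute z (g ^+ i) by apply: commuteX.
have zg : (z * g ^- i) d = d by rewrite permM zE permK.
have -> : z ^+ q = (z * g ^- i) ^+ q.
  rewrite expgMn; last exact/commuteV.
  by rewrite expgVn -expgM mulnC expgM -ord_g expg_order expg1n invg1 mulg1.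
exact: permX_fix.
Qed.

(** [h] and [k] act on [<[g]>] by raising to powers, so these actions commute and the commutator [z]
    centralises [g]. Among the fixed points of [g], [z] is the cycle [x], [y], [w]. As 3 does not
    divide [q], the power [z ^+ q] keeps a 3-cycle there, and it is trivial on [D]. *)
Lemma prime_cycle_3cycle x y w :
  q != 3 -> x \notin D -> y \notin D -> w \notin D -> uniq [:: x; y; w] ->
  exists t, [/\ t \in G, t != 1, odd_perm t = false &
    forall z, z \notin [:: x; y; w] -> t z = z].
Proof.
move=> nq3 nDx nDy nDw; rewrite /= !inE negb_or andbT => /andP[/andP[nxy nxw] nyw].
have [h [Gh Nh hx hy hz]] := prime_cycle_norm_swap nDx nDy nxy.
have [k [Gk Nk ky kw kz]] := prime_cycle_norm_swap nDy nDw nyw.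
pose z := h * k * (k * h)^-1.
have zC : z \in 'C[g].
  have powJ u : u \in 'N(<[g]>) -> exists i, g ^ u = g ^+ i.
    by move=> Nu; apply/cycleP; rewrite memJ_norm ?cycle_id.
  have [[i gi] [j gj]] := (powJ _ Nh, powJ _ Nk).
  have ghk : g ^ (h * k) = g ^ (k * h).
    by rewrite !conjgM gi gj !conjXg gi gj -!expgM mulnC.
  by apply/cent1P/esym/commgP/conjg_fixP; rewrite /z conjgM ghk -conjgM mulgV conjg1.
have zE v : z v = k^-1 (h^-1 (k (h v))) by rewrite /z invMg !permM.
have zx : z x = y.
  have hw : h w = w by rewrite hz // eq_sym.
  by rewrite zE hx ky -{1}hw permK -{1}ky permK.
have zy : z y = w by rewrite zE hy kz // -hy permK -kw permK.
have zw : z w = x by rewrite zE (hz w) 1?eq_sym // kw -{1}hx permK -{1}(kz x) ?permK.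
have z3 v : v \in [:: x; y; w] -> (z ^+ 3) v = v.
  by rewrite !inE permX => /or3P[]/eqP-> /=; rewrite ?(zx, zy, zw).
exists (z ^+ q); split.
- by rewrite groupX // !groupM ?groupV ?groupM.
- apply: contra nq3 => /eqP z1; have : (z ^+ q) x = x by rewrite z1 perm1.
  have zq3 : (z ^+ 3 ^+ (q %/ 3)) x = x by apply: permX_fix; rewrite z3 // !inE eqxx.
  rewrite {1}(divn_eq q 3) expgD mulnC expgM permM zq3.
  have : q %% 3 < 3 by rewrite ltn_mod.
  have : 3 %| q = (q == 3) by rewrite dvdn_prime2 // eq_sym.
  rewrite /dvdn; case: (q %% 3) => [|[|[|]]] //= <- // _; rewrite permX /= zx ?zy => E.
    by rewrite E eqxx in nxy.
  by rewrite E eqxx in nxw.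
- apply/negbTE; rewrite -Alt_even groupX // Alt_even /z.
  by rewrite !(odd_permM, odd_permV) [odd_perm k (+) _]addbC addbb.
- move=> v; rewrite !inE !negb_or => /and3P[nvx nvy nvw].
  have [Dv|nDv] := boolP (v \in D); first exact: prime_cycle_cent_expq.
  apply: permX_fix; rewrite zE hz // kz // -{1}(hz v) // permK -{1}(kz v) //.
  by rewrite permK.
Qed.

End PrimeCycle.

(** * A criterion for the full symmetric group *)

Lemma trans_prime_odd_Sym (T : finType) (q : nat) (G : {group {perm T}}) :
  prime q -> q + 2 < #|T| < 2 * q -> [transitive G, on setT | 'P] ->
  q %| #|G| -> ~~ (G \subset 'Alt_T) -> G :=: [set: {perm T}].
Proof.
move=> q_pr /andP[ltqT ltT2q] trG dvqG nGA.
have [g Gg ord_g] := Cauchy q_pr dvqG.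
pose D := ~: 'Fix_'P[g].
have DE x : (x \in D) = (g x != x).
  by rewrite inE; congr (~~ _); apply/afix1P/eqP.
have orbD d : d \in D -> #|orbit 'P <[g]> d| = q.
  move=> Dd; have := dvdn_orbit 'P <[g]> d; rewrite -/(#[g]) ord_g.
  case/(primeP q_pr).2/orP => /eqP // /card_orbit1 E.
  have : g d \in orbit 'P <[g]> d by apply: (mem_orbit 'P); apply: cycle_id.
  by move: Dd; rewrite DE E inE => /negbTE->.
have sub_orb d : d \in D -> orbit 'P <[g]> d \subset D.
  move=> Dd; apply/subsetP=> _ /orbitP[h /cycleP[i ->] <-].
  rewrite DE -[X in g X]/((g ^+ i) d) -permM -expgSr expgS permM.
  by rewrite (inj_eq (@perm_inj _ (g ^+ i))) -DE.
have [d Dd] : exists d, d \in D.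
  apply/existsP; apply: contraTT (prime_gt1 q_pr) => /existsPn nD.
  rewrite -ord_g (_ : g = 1) ?order1 //; apply/permP=> x; rewrite perm1.
  by apply/eqP; rewrite -[_ == _]negbK -DE nD.
(* A second orbit of length [q] does not fit into fewer than [2 * q] points, so [g] is a single
   [q]-cycle. *)
have orbE : orbit 'P <[g]> d = D.
  apply/eqP; rewrite eqEsubset sub_orb //=; apply/subsetP=> e De.
  apply: contraLR ltT2q => noe; rewrite -leqNgt mul2n -addnn.
  rewrite -{1}(orbD d Dd) -(orbD e De).
  have I0 : orbit 'P <[g]> d :&: orbit 'P <[g]> e = set0.
    apply/setP=> z; rewrite inE in_set0; apply/negP=> /andP[/orbit_eqP zd /orbit_eqP ze].
    by case/negP: noe; rewrite -zd ze orbit_refl.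
  by have := max_card (mem (orbit 'P <[g]> d :|: orbit 'P <[g]> e)); rewrite cardsU I0 cards0 subn0.
have g_trans : [transitive <[g]>, on D | 'P] by rewrite -orbE atrans_orbit.
have cardD : #|D| = q by rewrite -orbE orbD.
have /card_gt2P[x [y [w [[nDx nDy nDw] [nxy nyw nwx]]]]] : 2 < #|~: D|.
  by rewrite cardsCs setCK cardD ltn_subRL.
move: nDx nDy nDw; rewrite ![_ \in ~: D](in_setC _ D) => nDx nDy nDw.
have F z : z \notin D -> z \in 'Fix_'P[g] by rewrite in_setC negbK.
(* [q = 3] would require [5 < #|T| < 6]. *)
have nq3 : q != 3 by apply: contraTneq ltqT => q3; move: ltT2q; rewrite q3 -leqNgt -ltnS.
have uxyw : uniq [:: x; y; w] by rewrite /= !inE negb_or nxy nyw eq_sym nwx.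
have [t [Gt nt1 t_even t_fix]] :=
  prime_cycle_3cycle q_pr g_trans cardD ord_g trG Gg ltT2q nq3 nDx nDy nDw uxyw.
have trS := prime_cycle_astab_trans q_pr g_trans cardD ord_g trG Gg ltT2q.
have tr1 : [transitive 'C_G([set x] | 'P), on ~: [set x] | 'P].
  by apply: trS; rewrite sub1set F.
have tr2 : [transitive 'C_G([set x; y] | 'P), on ~: [set x; y] | 'P].
  by apply: trS; rewrite subUset !sub1set !F.
(* Triple transitivity: [h1], [h2], [h3] put [x'], [y'], [w'] in place one after the other, each
   fixing the points already placed. *)
have trip x' y' w' : x' != y' -> y' != w' -> w' != x' ->
    exists h, [/\ h \in G, h x = x', h y = y' & h w = w'].
  move=> nx'y' ny'w' nw'x'.
  have [h1 Gh1 E1] := atransP2 trG (in_setT x') (in_setT x).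
  have [||h2 /setIP[Gh2 /astabP f2] E2] := atransP2 tr1 (x := h1 y') (y := y).
  - by rewrite !inE [x]E1 (inj_eq perm_inj) eq_sym.
  - by rewrite !inE eq_sym.
  have [||h3 /setIP[Gh3 /astabP f3] E3] := atransP2 tr2 (x := h2 (h1 w')) (y := w).
  - have ex : x = h2 (h1 x') by rewrite -[h1 x']E1 [h2 x]f2 ?inE.
    rewrite in_setC in_set2 negb_or ex [y]E2 !(inj_eq perm_inj) nw'x' eq_sym.
    exact: ny'w'.
  - by rewrite !inE negb_or nwx eq_sym.
  exists (h1 * h2 * h3)^-1; rewrite groupV !groupM //.
  have inv (h : {perm T}) u v : h u = v -> h^-1 v = u by move=> <-; rewrite permK.
  split=> //; apply: inv; rewrite !permM.
  - by rewrite -[h1 x']E1 [h2 x]f2 ?[h3 x]f3 // !inE eqxx.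
  - by rewrite -[h2 _]E2 [h3 y]f3 // !inE eqxx orbT.
  - by rewrite -[h3 _]E3.
(* [t] moves only [x], [y], [w], so [t ^ s] depends only on the images of these three points, which
   some [h] in [G] realises too. *)
have conjG s : t ^ s \in G.
  have [|||h [Gh hx hy hw]] := trip (s x) (s y) (s w); rewrite ?(inj_eq perm_inj) //.
  suff -> : t ^ s = t ^ h by rewrite groupJ.
  have hs : {in [:: x; y; w], h =1 s} by move=> v; rewrite !inE => /or3P[]/eqP->.
  have stab v : v \in [:: x; y; w] -> t v \in [:: x; y; w].
    move=> vM; apply: contraLR vM => nM; rewrite -{1}(permK t v).
    have : t (t v) = t v by apply: t_fix.
    by move/perm_inj=> tv; rewrite permK -tv.
  apply/permP=> z.
  have [Mz|nMz] := boolP (s^-1 z \in [:: x; y; w]).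
    rewrite -(permKV s z) permJ -{1}(hs _ Mz) permJ.
    by rewrite (hs (t _)) ?stab.
  have nMz' : h^-1 z \notin [:: x; y; w].
    by apply: contra nMz => Mz; rewrite -(permKV h z) (hs _ Mz) permK.
  by rewrite -{1}(permKV s z) -{2}(permKV h z) !permJ !t_fix // !permKV.
pose N := <<t ^: [set: {perm T}]>>.
have sNG : N \subset G by rewrite gen_subG; apply/subsetP=> _ /imsetP[s _ ->].
have T5 : 4 < #|T|.
  have q3 : 2 < q.
    by rewrite -(ltn_add2l q) addnn -mul2n (ltn_trans ltqT).
  by rewrite (leq_trans _ ltqT) // addn2 !ltnS ltnW.
(* The conjugates of [t] generate a nontrivial normal subgroup of ['Alt_T], which is simple on at
   least five points. *)
have [_ simA] := simpleP _ (simple_Alt5 T5).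
have sNA : N \subset 'Alt_T.
  by rewrite gen_subG; apply/subsetP=> _ /imsetP[s _ ->]; rewrite Alt_even odd_permJ t_even.
have nNA : [group of N] <| 'Alt_T.
  rewrite /normal sNA /=; apply/subsetP=> s _; rewrite inE -genJ.
  by rewrite gen_subG; apply/subsetP=> _ /imsetP[_ /imsetP[u _ ->] ->]; rewrite -conjgM mem_gen // imset_f // inE.
have sAG : 'Alt_T \subset G.
  have [N1|<- //] := simA _ nNA.
  have tN : t \in N by apply/mem_gen/class_refl.
  by move: tN nt1; rewrite [N]N1 => /set1gP ->; rewrite eqxx.
have [o Go odd_o] := subsetPn nGA.
apply/eqP; rewrite eqEsubset subsetT; apply/subsetP=> s _.
have [os|os] := boolP (odd_perm s); last by rewrite (subsetP sAG) // Alt_even.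
rewrite -(mulgKV o s) groupM // (subsetP sAG) // Alt_even odd_permM odd_permV os.
by move: odd_o; rewrite Alt_even negbK => ->.
Qed.

Local Close Scope group_scope.
Local Open Scope ring_scope.

(** * Extension of p-adic valuations *)

Section MaximalSubring.

Variable L : fieldType.

Lemma ex_maximal_subring_avoiding (u : L) :
  (forall z : int, u <> z%:~R) ->
  exists2 S : subringClosed L, u \notin S &
    forall S' : subringClosed L, {subset S <= S'} -> u \notin S' ->
      {subset S' <= S}.
Proof.
move=> nZu.
pose isub (A : L -> Prop) := [/\ A 1, forall x y, A x -> A y -> A (x - y)
  & forall x y, A x -> A y -> A (x * y)].
pose P (A : L -> Prop) := (forall x, ~ A x) \/ (isub A /\ ~ A u).
have [|A [PA maxA]] := @classical_sets.Zorn_bigcup L P.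
  move=> F FP totF.
  have [[X0 [FX0 [x0 X0x0]]]|nF] := boolp.pselect (exists X, F X /\ exists x, X x); last first.
    by left=> x [X FX Xx]; apply: nF; exists X; split=> //; exists x.
  have isF X x : F X -> X x -> isub X /\ ~ X u.
    by move=> FX Xx; have [nX|//] := FP X FX; case: (nX x).
  have two x y : (exists2 X, F X & X x) -> (exists2 X, F X & X y) ->
      exists X, [/\ F X, X x & X y].
    move=> [X FX Xx] [Y FY Yy]; have [sXY|sYX] := totF X Y FX FY.
      by exists Y; split=> //; apply: sXY.
    by exists X; split=> //; apply: sYX.
  right; split; last by case=> X FX Xu; have [_] := isF _ _ FX Xu; apply.
  split.
  - by exists X0 => //; have [[]] := isF _ _ FX0 X0x0.
  - move=> x y Fx Fy; have [X [FX Xx Xy]] := two x y Fx Fy.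
    by exists X => //; have [[_ sX _] _] := isF _ _ FX Xx; apply: sX.
  - move=> x y Fx Fy; have [X [FX Xx Xy]] := two x y Fx Fy.
    by exists X => //; have [[_ _ mX] _] := isF _ _ FX Xx; apply: mX.
have [nA|[[A1 Asub Amul] nAu]] := PA.
  pose B (x : L) := exists z : int, x = z%:~R.
  case: (maxA B).
    split=> [x /nA //|sBA]; apply: (nA 1); apply: sBA.
    by exists 1.
  right; split; last by case=> z /nZu.
  split; first by exists 1.
  - by move=> _ _ [x ->] [y ->]; exists (x - y); rewrite intrB.
  - by move=> _ _ [x ->] [y ->]; exists (x * y); rewrite intrM.
pose S : {pred L} := fun x => boolp.asbool (A x).
have SE x : reflect (A x) (x \in S) by apply: boolp.asboolP.
have Ssub : subring_closed S.
  by split=> [|x y /SE Ax /SE Ay|x y /SE Ax /SE Ay]; apply/SE; auto.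
pose S0 : subringClosed L := HB.pack_for (subringClosed L) S (GRing.isSubringClosed.Build L S Ssub).
exists S0; first by apply/SE.
move=> S' sSS' nS'u x S'x; apply/SE; apply: boolp.contrapT => nAx.
case: (maxA (fun y => y \in S')).
  split=> [y Ay|sS'A]; last by apply: nAx; apply: sS'A.
  by apply: sSS'; apply/SE.
right; split; last exact/negP.
by split=> [|y z|y z]; [apply: rpred1|apply: rpredB|apply: rpredM].
Qed.

Variables (S : subringClosed L) (pi : L).
Hypothesis pi_neq0 : pi != 0.
Hypothesis S_pi : pi \in S.
Hypothesis nS_piV : pi^-1 \notin S.
Hypothesis maxS : forall S' : subringClosed L, {subset S <= S'} ->
  pi^-1 \notin S' -> {subset S' <= S}.

(** Otherwise the ring generated by [S] and [x] would avoid [pi^-1] and be strictly larger than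
    [S]. *)
Lemma maximal_subring_adjoin x :
  x \notin S -> exists2 P, P \is a polyOver S & P.[x] = pi^-1.
Proof.
move=> nSx; apply: boolp.contrapT => nP.
pose B : {pred L} := fun y => boolp.asbool (exists2 P, P \is a polyOver S & P.[x] = y).
have BE y : reflect (exists2 P, P \is a polyOver S & P.[x] = y) (y \in B) by apply: boolp.asboolP.
have Bsub : subring_closed B.
  split=> [|_ _ /BE[P SP <-] /BE[Q SQ <-]|_ _ /BE[P SP <-] /BE[Q SQ <-]]; apply/BE.
  - by exists 1; rewrite ?hornerC // rpred1.
  - by exists (P - Q); rewrite ?hornerE // rpredB.
  - by exists (P * Q); rewrite ?hornerE // rpredM.
pose B0 : subringClosed L := HB.pack_for (subringClosed L) B (GRing.isSubringClosed.Build L B Bsub).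
case/negP: nSx; apply: (maxS (S' := B0)); last 1 first.
- by apply/BE; exists 'X; rewrite ?hornerX ?polyOverX.
- by move=> y Sy; apply/BE; exists y%:P; rewrite ?hornerC ?polyOverC.
- by apply/BE.
Qed.

(** Powers of [z = 1 - pi * b] are 1 modulo [pi * S]. If [pi^-1] is a polynomial in [z^-1] over [S],
    multiplying by a power of [z] clears the denominators and leaves [pi^-1] in [S]. *)
Lemma maximal_subring_unit b : b \in S -> (1 - pi * b)^-1 \in S.
Proof.
move=> Sb; set z := 1 - pi * b.
have Sz : z \in S by rewrite rpredB ?rpred1 ?rpredM.
have z_neq0 : z != 0.
  apply: contra nS_piV; rewrite subr_eq0 => /eqP pib.
  by rewrite (_ : pi^-1 = b) //; apply: (mulfI pi_neq0); rewrite divff.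
apply: contraNT nS_piV => /maximal_subring_adjoin[P SP Pz].
have zX n : exists2 b', b' \in S & z ^+ n = 1 - pi * b'.
  elim: n => [|n [b' Sb' IHn]]; first by exists 0; rewrite ?rpred0 // mulr0 subr0.
  exists (b + b' - pi * b * b'); last by rewrite exprS IHn /z; ring.
  by rewrite rpredB ?rpredD ?rpredM.
have Se : P.[z^-1] * z ^+ size P \in S.
  rewrite horner_coef mulr_suml rpred_sum // => i _.
  have -> : z ^+ size P = z ^+ i * z ^+ (size P - i) by rewrite -exprD subnKC // ltnW.
  rewrite exprVn -mulrA [X in _ * X]mulrA mulVf ?expf_neq0 // mul1r.
  by rewrite rpredM ?rpredX ?(polyOverP SP).
have [b' Sb' zE] := zX (size P).
have -> : pi^-1 = P.[z^-1] * z ^+ size P + b'.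
  by rewrite Pz zE mulrBr mulr1 mulrA mulVf // mul1r subrK.
by rewrite rpredD.
Qed.

(* If neither x nor 1/x is in S, then pi^-1 is a polynomial in x and in 1/x with
   coefficients in S; the second relation lowers the degree of the first one. *)
Lemma maximal_subring_valuation x : (x \in S) || (x^-1 \in S).
Proof.
apply/norP=> -[/maximal_subring_adjoin[P SP Px] /maximal_subring_adjoin[Q SQ Qx]].
have [n] := ubnP (size P + size Q); elim: n => // n IHn in x P Q SP SQ Px Qx *.
wlog leQP : x P Q SP SQ Px Qx / (size Q <= size P)%N.
  move=> IH; case: (leqP (size Q) (size P)) => [|/ltnW] lePQ; first exact: (IH x P Q).
  by rewrite addnC; apply: (IH x^-1 Q P); rewrite ?invrK.
move=> ltn.
have piV_neq0 : pi^-1 != 0 by rewrite invr_eq0.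
have P_neq0 : P != 0 by apply: contraNneq piV_neq0 => P0; rewrite -Px P0 horner0.
have x_neq0 : x != 0.
  apply: contraNneq nS_piV => x0; rewrite -Px x0 horner_coef0.
  exact: (polyOverP SP).
have sizeP_gt0 : (0 < size P)%N by rewrite size_poly_gt0.
pose d := (size P).-1; have sizeP : size P = d.+1 by rewrite prednK.
pose v := (1 - pi * Q`_0)^-1.
have Sv : v \in S by apply/maximal_subring_unit/(polyOverP SQ).
have v_unit : 1 - pi * Q`_0 != 0.
  apply: contra nS_piV; rewrite subr_eq0 => /eqP piQ.
  rewrite (_ : pi^-1 = Q`_0); first exact: (polyOverP SQ).
  by apply: (mulfI pi_neq0); rewrite divff.
have sizeQ : (size Q <= d.+1)%N by rewrite -sizeP.
(* Multiplying [Q.[x^-1] = pi^-1] by [pi * x ^+ d] expresses a unit of [S] times [x ^+ d] as [pi *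
   R.[x]], with [R] of degree below [d]. This replaces the leading term of [P]. *)
pose R := \poly_(j < d) Q`_(d - j).
have SR : R \is a polyOver S.
  by apply/polyOverP=> j; rewrite coef_poly; case: ifP; rewrite ?rpred0 ?(polyOverP SQ).
have QR : x ^+ d * (1 - pi * Q`_0) = pi * R.[x].
  have : pi * (x ^+ d * Q.[x^-1]) = x ^+ d by rewrite Qx mulrCA divff ?mulr1.
  rewrite (horner_coef_wide _ sizeQ) big_ord_recl expr0 mulr1 mulrDr mulrDr => E.
  rewrite mulrBr mulr1 -{1}E [x ^+ d * (pi * _)]mulrCA addrAC subrr add0r.
  congr (_ * _); rewrite horner_poly (reindex_inj rev_ord_inj) mulr_sumr.
  apply: eq_bigr => j _; rewrite lift0 /= subnSK // mulrCA; congr (_ * _).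
  rewrite -[X in x ^+ X](subnKC (ltnW (ltn_ord j))) exprD exprVn -mulrA.
  by rewrite divff ?mulr1 // expf_neq0.
pose P2 := \poly_(i < d) P`_i + (P`_d * v * pi) *: R.
apply: (IHn x P2 Q) => //.
- rewrite rpredD ?polyOverZ ?rpredM ?(polyOverP SP) //.
  by apply/polyOverP=> j; rewrite coef_poly; case: ifP; rewrite ?rpred0 ?(polyOverP SP).
- have QR' : v * (pi * R.[x]) = x ^+ d by rewrite -QR mulrC mulfK.
  rewrite hornerD hornerZ horner_poly -!mulrA QR'.
  by rewrite -Px horner_coef sizeP big_ord_recr.
- rewrite -ltnS; apply: leq_trans ltn; rewrite ltnS ltn_add2r sizeP ltnS.
  rewrite (leq_trans (size_polyD _ _)) // geq_max size_poly.
  by rewrite (leq_trans (size_scale_leq _ _)) ?size_poly.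
Qed.

End MaximalSubring.
(* w 0 is a junk value, hence the disjunctions with x == 0. *)
Definition padic_valuation (L : fieldType) (p : nat) (w : L -> rat) :=
  [/\ {in predC1 0 &, {morph w : x y / x * y >-> x + y}},
      forall c x y, (x == 0) || (c <= w x) -> (y == 0) || (c <= w y) ->
        (x + y == 0) || (c <= w (x + y))
    & forall n, (0 < n)%N -> w n%:R = (logn p n)%:R].

(* Every x != 0 is algebraic over rat, so some power x ^+ n is p ^ e times a unit
   of S; then w x = e / n. *)
Section ValuationOfRing.

Variables (L : fieldExtType rat) (p : nat) (S : subringClosed L).
Hypothesis p_pr : prime p.
Hypothesis valS : forall x, (x \in S) || (x^-1 \in S).
Let pi : L := p%:R.
Hypothesis nS_piV : pi^-1 \notin S.

Let vunit (x : L) := [&& x != 0, x \in S & x^-1 \in S].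

Let natr_neq0 n : (0 < n)%N -> n%:R != 0 :> L.
Proof.
move=> n_gt0; rewrite -(rmorph_nat (in_alg L)) fmorph_eq0.
by rewrite pnatr_eq0 -lt0n.
Qed.

Let pi_neq0 : pi != 0. Proof. exact/natr_neq0/prime_gt0. Qed.
Let S_pi : pi \in S. Proof. exact: rpred_nat. Qed.

Let vunit1 : vunit 1. Proof. by rewrite /vunit oner_neq0 invr1 rpred1. Qed.

Let vunitM x y : vunit x -> vunit y -> vunit (x * y).
Proof.
move=> /and3P[x0 Sx SVx] /and3P[y0 Sy SVy].
by rewrite /vunit mulf_neq0 // invfM !rpredM.
Qed.

Let vunitV x : vunit x -> vunit x^-1.
Proof. by move=> /and3P[x0 Sx SVx]; rewrite /vunit invr_eq0 invrK x0 Sx SVx. Qed.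

Let vunitX x n : vunit x -> vunit (x ^+ n).
Proof. by move=> Ux; elim: n => // n IHn; rewrite exprS vunitM. Qed.

Let vunit_exprz z : vunit (pi ^ z) -> z = 0.
Proof.
suff nz n : ~~ vunit (pi ^+ n.+1).
  case: z => [[|n]|n] //; first by move/(negP (nz n)).
  by rewrite NegzE -exprnN => /vunitV; rewrite invrK => /(negP (nz n)).
apply/negP=> /and3P[_ _ SV]; case/negP: nS_piV.
rewrite (_ : pi^-1 = pi ^- n.+1 * pi ^+ n) ?rpredM ?rpredX //.
by rewrite exprSr invfM mulrAC mulVf ?mul1r // expf_neq0.
Qed.

(** Divide a Bezout relation [1 = u%:R * n%:R - v%:R * pi]: by [pi], to see that [n%:R / pi] is not
    in [S]; then by [n%:R], using that its inverse is. *)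
Let vunit_coprime n : coprime p n -> vunit n%:R.
Proof.
move=> co_pn.
have n_gt0 : (0 < n)%N.
  by case: n co_pn => //; rewrite /coprime gcdn0 => /eqP p1; move: p_pr; rewrite p1.
have n0 := natr_neq0 n_gt0.
rewrite /vunit n0 rpred_nat /=.
have [u v /= + _] := egcdnP p n_gt0.
rewrite gcdnC (eqP co_pn) => /(congr1 (fun m => m%:R : L)).
rewrite natrD !natrM => E.
have {E}E : 1 = u%:R * n%:R - v%:R * pi by rewrite E; ring.
have [Sx|] := orP (valS (n%:R / pi)).
  case/negP: nS_piV; rewrite -[pi^-1]mul1r E mulrBl mulfK // -mulrA.
  by apply: rpredB; [apply: rpredM => //|]; apply: rpred_nat.
rewrite invfM invrK => Sx; rewrite -[_^-1]mul1r {1}E mulrBl mulfK //.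
apply: rpredB; first exact: rpred_nat.
by rewrite -mulrA [pi * _]mulrC; apply: rpredM => //; apply: rpred_nat.
Qed.

Let vunit_natr n : (0 < n)%N -> vunit (n%:R / pi ^ (logn p n)%:Z).
Proof.
move=> n_gt0; have [m co_pm {1}->] := pfactor_coprime p_pr n_gt0.
by rewrite natrM natrX mulfK ?expf_neq0 // vunit_coprime.
Qed.

Let vunit_rat r : r != 0 -> exists e : int, vunit (r%:A / pi ^ e).
Proof.
move=> r_neq0.
have intu z : z != 0 -> exists e : int, vunit (z%:~R / pi ^ e).
  move=> z_neq0; exists (logn p `|z|%N)%:Z.
  have := @vunit_natr `|z|%N; rewrite absz_gt0 => /(_ z_neq0).
  case: z {z_neq0} => n /=; first by [].
  move/and3P=> [U0 U1 U2].
  rewrite NegzE mulrNz mulNr; rewrite /vunit oppr_eq0 invrN !rpredN -pmulrn.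
  by apply/and3P; split.
have [e Ue] := intu (numq r) (etrans (congr1 negb (numq_eq0 r)) r_neq0).
have [f Uf] := intu (denq r) (denq_neq0 r).
exists (e - f); have := vunitM Ue (vunitV Uf).
rewrite invfM invrK -[in r%:A](divq_num_den r).
rewrite -[_%:A]/(in_alg L _) fmorph_div !rmorph_int expfzDr // -invr_expz.
by rewrite invfM invrK mulrACA.
Qed.

(** The nonunits of a valuation ring form an ideal: when [y / x] is in [S], a unit [x + y] would
    make [x] a unit. *)
Let vnonunitD x y : x \in S -> y \in S -> ~~ vunit x -> ~~ vunit y -> ~~ vunit (x + y).
Proof.
move=> Sx Sy.
have [->|x0] := eqVneq x 0; first by rewrite add0r.
have [->|y0] := eqVneq y 0; first by rewrite addr0.
wlog Syx : x y x0 y0 Sx Sy / y / x \in S.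
  move=> IH nx ny; have [Syx|] := orP (valS (y / x)); first exact: (IH x y).
  by rewrite invf_div addrC => Sxy; apply: (IH y x).
move=> nx _; apply: contra nx => /and3P[xy0 _ SVxy].
rewrite /vunit x0 Sx /= (_ : x^-1 = (1 + y / x) * (x + y)^-1).
  by rewrite rpredM ?rpredD ?rpred1.
by field; rewrite ?xy0 ?x0.
Qed.

(** The least valuation occurs twice in a vanishing sum: divide by a term [F i0] of least valuation;
    if all other quotients were nonunits, so would be 1. *)
Let sum0_vunit (I : finType) (F : I -> L) :
  \sum_i F i = 0 -> (exists i, F i != 0) ->
  exists ij : I * I, [/\ ij.1 != ij.2, F ij.1 != 0, F ij.2 != 0
    & vunit (F ij.1 / F ij.2)].
Proof.
move=> sumF [i1 Fi1].
have [i0 Fi0 minF] : exists2 i0, F i0 != 0 & forall i, F i / F i0 \in S.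
  suff [i0 Fi0 minF] : exists2 i0, F i0 != 0 & {in i1 :: enum I, forall i, F i / F i0 \in S}.
    by exists i0 => // i; apply: minF; rewrite inE mem_enum orbT.
  elim: (enum I) => [|j s [i0 Fi0 IH]].
    by exists i1 => // i; rewrite inE => /eqP ->; rewrite divff // rpred1.
  have IH1 i : i \in i1 :: s -> F i / F i0 \in S by apply: IH.
  have [S1|S1] := orP (valS (F j / F i0)).
    exists i0 => // i; rewrite !inE orbCA => /orP[/eqP->//|].
    by rewrite -in_cons; apply: IH1.
  have [Fj|Fj] := eqVneq (F j) 0.
    exists i0 => // i; rewrite !inE orbCA => /orP[/eqP->|]; first by rewrite Fj mul0r rpred0.
    by rewrite -in_cons; apply: IH1.
  exists j => // i; rewrite !inE orbCA => /orP[/eqP->|]; first by rewrite divff // rpred1.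
  rewrite -in_cons => /IH1 Si; rewrite (_ : F i / F j = (F i / F i0) * (F j / F i0)^-1).
    exact: rpredM.
  by field; rewrite Fi0 Fj.
have /existsP[i /andP[nii0 Ui]] : [exists i, (i != i0) && vunit (F i / F i0)].
  apply: contraT => /existsPn nU.
  have [_ nV] : (- \sum_(i | i != i0) F i / F i0 \in S) /\ ~~ vunit (- \sum_(i | i != i0) F i / F i0).
    split; first by rewrite rpredN rpred_sum.
    rewrite /vunit oppr_eq0 invrN !rpredN -/(vunit _).
    suff [] : (\sum_(i | i != i0) F i / F i0 \in S) /\ ~~ vunit (\sum_(i | i != i0) F i / F i0) by [].
    apply: (big_ind (fun x => x \in S /\ ~~ vunit x)).
    - by rewrite rpred0 /vunit eqxx.
    - by move=> x y [Sx nx] [Sy ny]; rewrite rpredD // vnonunitD.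
    - by move=> i ni; split=> //; move: (nU i); rewrite ni.
  move: sumF; rewrite (bigD1 i0) //= => /(congr1 (fun x => x / F i0)).
  rewrite mul0r mulrDl divff // mulr_suml => /eqP; rewrite addr_eq0 => /eqP E.
  by move: nV; rewrite -E; rewrite vunit1.
exists (i, i0); split=> //=.
by case/and3P: Ui => + _ _; apply: contra => /eqP ->; rewrite mul0r.
Qed.

(** Two terms of the minimal polynomial at [x] have a unit as quotient, so some positive power of
    [x] is a unit times a rational number, hence a unit times a power of [pi]. *)
Let vunit_power x : x != 0 ->
  exists ne : nat * int, (0 < ne.1)%N && vunit (x ^+ ne.1 / pi ^ ne.2).
Proof.
move=> x0.
have [q qE] : exists q, minPoly 1 x = map_poly (in_alg L) q.
  by apply/polyOver1P; apply: minPolyOver.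
have q0 : q != 0.
  by rewrite -(map_poly_eq0 (in_alg L)) -qE monic_neq0 // monic_minPoly.
have qx : \sum_(i < size q) (q`_i)%:A * x ^+ i = 0.
  have /eqP := root_minPoly 1 x; rewrite qE horner_coef size_map_poly => E.
  rewrite -[RHS]E; by apply: eq_bigr => i _; rewrite coef_map.
have [|[i j] /= [nij qi qj Uij]] := sum0_vunit qx.
  have lt_s : ((size q).-1 < size q)%N by rewrite prednK ?size_poly_gt0.
  exists (Ordinal lt_s) => /=; rewrite mulf_neq0 ?expf_neq0 //.
  by rewrite -[_%:A]/(in_alg L _) fmorph_eq0 -/(lead_coef q) lead_coef_eq0.
wlog ltji : i j nij qi qj Uij / (j < i)%N.
  move=> IH; case: (ltngtP i j) => [ltij|ltji|eqij]; last 1 first.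
  - by move: nij; rewrite -val_eqE /= eqij eqxx.
  - by apply: (IH j i) => //; rewrite 1?eq_sym // -invf_div vunitV.
  - exact: (IH i j).
have qi0 : q`_i != 0 by move: qi; apply: contraNneq => ->; rewrite scale0r mul0r.
have qj0 : q`_j != 0 by move: qj; apply: contraNneq => ->; rewrite scale0r mul0r.
have [e Ue] := vunit_rat qi0; have [f Uf] := vunit_rat qj0.
exists ((i - j)%N, f - e); rewrite subn_gt0 ltji /=.
have := vunitM (vunitM Uij (vunitV Ue)) Uf.
have qiA : (q`_i)%:A != 0 :> L by rewrite -[_%:A]/(in_alg L _) fmorph_eq0.
have qjA : (q`_j)%:A != 0 :> L by rewrite -[_%:A]/(in_alg L _) fmorph_eq0.
congr (is_true (vunit _)).
rewrite -[in x ^+ i](subnK (ltnW ltji)) exprD expfzDr // -invr_expz.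
by field; rewrite ?qiA ?qjA ?expf_neq0 ?expfz_neq0.
Qed.

(** The implication covers [x = 0], so that [xchoose] can define [w] on all of [L]. *)
Let vunit_power_eq0 x :
  exists ne : nat * int, (x != 0) ==> ((0 < ne.1)%N && vunit (x ^+ ne.1 / pi ^ ne.2)).
Proof.
by have [->|/vunit_power[ne Une]] := eqVneq x 0; [exists (0%N, 0)|exists ne].
Qed.

Let w x : rat := let ne := xchoose (vunit_power_eq0 x) in ne.2%:~R / ne.1%:R.

(** Independence of the choice: two pairs [(n, e)] and [(m, f)] make [pi ^ (f * n - e * m)] a unit,
    which forces the exponent to vanish. *)
Let wE x n e : x != 0 -> (0 < n)%N -> vunit (x ^+ n / pi ^ e) -> w x = e%:~R / n%:R.
Proof.
move=> x0 n_gt0 Ux; rewrite /w; set ne := xchoose _.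
have := xchooseP (vunit_power_eq0 x); rewrite -/ne x0 /=.
case: ne => m f /= /andP[m_gt0 Um].
have /vunit_exprz : vunit (pi ^ (f * n%:Z - e * m%:Z)).
  have := vunitM (vunitX m Ux) (vunitV (vunitX n Um)); congr (is_true (vunit _)).
  have piX z k : (pi ^ z) ^+ k = pi ^ (z * k%:Z) by rewrite exprnP exprz_exp.
  rewrite expfzDr // -invr_expz !expr_div_n -!exprM !piX mulnC.
  by field; rewrite ?expfz_neq0 ?expf_neq0.
move/eqP; rewrite subr_eq0 => /eqP /(congr1 (intr : int -> rat)).
rewrite !intrM !pmulrn => E.
apply/eqP; rewrite eqr_div ?pnatr_eq0 -?lt0n //; exact/eqP.
Qed.

Let w_power x : x != 0 ->
  exists n e, [/\ (0 < n)%N, vunit (x ^+ n / pi ^ e) & w x = e%:~R / n%:R].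
Proof.
move=> x0; have [[n e] /andP[n_gt0 Ux]] := vunit_power x0.
by exists n, e; split=> //; apply: wE.
Qed.

Let wM : {in predC1 0 &, {morph w : x y / x * y >-> x + y}}.
Proof.
move=> x y x0 y0.
have [n [e [n_gt0 Ux ->]]] := w_power x0; have [m [f [m_gt0 Uy ->]]] := w_power y0.
rewrite (@wE _ (n * m) (e * m%:Z + f * n%:Z)) ?mulf_neq0 ?muln_gt0 ?n_gt0 //.
  rewrite intrD !intrM natrM -!pmulrn; field.
  by rewrite !pnatr_eq0 -!lt0n n_gt0 m_gt0.
have := vunitM (vunitX m Ux) (vunitX n Uy); congr (is_true (vunit _)).
have piX z k : (pi ^ z) ^+ k = pi ^ (z * k%:Z) by rewrite exprnP exprz_exp.
rewrite expfzDr // !expr_div_n -!exprM !piX exprMn [(m * n)%N]mulnC.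
by field; rewrite ?expfz_neq0.
Qed.

(** If [e >= 0], then [x ^+ n] is in [S], and should [x^-1] be in [S], multiplying by its power
    [n - 1] gives [x]. If [e < 0], having [x] in [S] would put [pi^-1] in [S]. *)
Let w_ge0 x : x != 0 -> (0 <= w x) = (x \in S).
Proof.
move=> x0; have [n [e [n_gt0 Ux ->]]] := w_power x0.
rewrite pmulr_lge0 ?invr_gt0 ?ltr0n // ler0z.
have /and3P[_ S1 S2] := Ux.
case: e {Ux} S1 S2 => k S1 S2.
  rewrite le0z_nat; apply/esym; have [//|SVx] := orP (valS x).
  have Sxn : x ^+ n \in S.
    by rewrite -[x ^+ n](divfK (expf_neq0 k pi_neq0)) rpredM ?rpredX.
  rewrite -(prednK n_gt0) exprS in Sxn.
  rewrite -[x](mulfK (expf_neq0 n.-1 x0)) -exprVn rpredM ?rpredX //.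
apply/esym/negbTE/negP=> Sx; case/negP: nS_piV.
rewrite (_ : pi^-1 = pi ^ (Negz k) * pi ^+ k); last first.
  by rewrite NegzE -exprnN exprSr invfM mulrAC mulVf ?mul1r // expf_neq0.
have -> : pi ^ Negz k = x ^+ n * (x ^+ n / pi ^ Negz k)^-1.
  by rewrite invf_div mulrC divfK ?expf_neq0.
by rewrite !rpredM ?rpredX.
Qed.

Let wD c x y : (x == 0) || (c <= w x) -> (y == 0) || (c <= w y) ->
  (x + y == 0) || (c <= w (x + y)).
Proof.
have [->|x0] := eqVneq x 0; first by rewrite add0r.
have [->|y0] := eqVneq y 0; first by rewrite addr0 (negbTE x0).
have [//|xy0] := eqVneq (x + y) 0; rewrite /=.
wlog lexy : x y x0 y0 xy0 / w x <= w y.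
  move=> IH cx cy; case: (leP (w x) (w y)) => [|/ltW] le; first exact: (IH x y).
  by rewrite addrC; apply: (IH y x) => //; rewrite addrC.
move=> cx _; apply: le_trans cx _.
have yE : y / x * x = y by rewrite divfK.
have yx0 : y / x != 0 by rewrite mulf_neq0 ?invr_eq0.
have Syx : y / x \in S.
  by rewrite -w_ge0 // -(lerD2r (w x)) add0r -wM ?yE.
have E : x + y = (1 + y / x) * x by rewrite mulrDl mul1r yE.
have n0 : 1 + y / x != 0 by move: xy0; rewrite E mulf_eq0 negb_or => /andP[].
by rewrite E wM // lerDr w_ge0 // rpredD ?rpred1.
Qed.

Let w_natr n : (0 < n)%N -> w n%:R = (logn p n)%:R.
Proof.
move=> n_gt0; rewrite (@wE _ 1 (logn p n)%:Z) ?natr_neq0 ?expr1 ?vunit_natr //.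
by rewrite divr1 -pmulrn.
Qed.

Lemma valuation_of_ring : exists w, padic_valuation (L := L) p w.
Proof. by exists w; split; [apply: wM|apply: wD|apply: w_natr]. Qed.

End ValuationOfRing.

Lemma ex_padic_valuation (L : fieldExtType rat) (p : nat) :
  prime p -> exists w, padic_valuation (L := L) p w.
Proof.
move=> p_pr; have inj := fmorph_inj (in_alg L).
have p0 : p%:R != 0 :> L.
  by rewrite -(rmorph_nat (in_alg L)) fmorph_eq0 pnatr_eq0 -lt0n prime_gt0.
have nZ (z : int) : (p%:R : L)^-1 <> z%:~R.
  move=> E; have : p%:R * z%:~R = 1 :> L by rewrite -E divff.
  rewrite -(rmorph_nat (in_alg L)) -(rmorph_int (in_alg L)) -rmorphM -(rmorph1 (in_alg L)).
  move/inj; rewrite pmulrn -intrM => /eqP; rewrite -[1]/(1%:~R) eqr_int => /eqP E1.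
  have := congr1 absz E1; rewrite abszM /= => /eqP; rewrite muln_eq1 => /andP[/eqP p1 _].
  by move: p_pr; rewrite p1.
have [S nSV maxS] := ex_maximal_subring_avoiding nZ.
apply: (valuation_of_ring p_pr (S := S)) => // x.
by apply: (maximal_subring_valuation p0 _ nSV maxS); apply: rpred_nat.
Qed.

(** * Ultrametric rules for a valuation *)

Section PadicValuation.

Variables (L : fieldExtType rat) (p : nat) (w : L -> rat).
Hypothesis vw : padic_valuation p w.

Lemma valM x y : x != 0 -> y != 0 -> w (x * y) = w x + w y.
Proof. by case: vw => wM _ _ x0 y0; apply: wM. Qed.

Lemma val1 : w 1 = 0.
Proof. by case: vw => _ _ /(_ 1%N isT); rewrite logn1. Qed.

Lemma valX x n : x != 0 -> w (x ^+ n) = n%:R * w x.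
Proof.
move=> x0; elim: n => [|n IHn]; first by rewrite expr0 val1 mul0r.
by rewrite exprS valM ?expf_neq0 // IHn mulrS mulrDl mul1r.
Qed.

Lemma valV x : x != 0 -> w x^-1 = - w x.
Proof.
move=> x0; apply/eqP; rewrite -subr_eq0 opprK -valM ?invr_eq0 //.
by rewrite mulVf // val1.
Qed.

Lemma valN x : w (- x) = w x.
Proof.
have [->|x0] := eqVneq x 0; first by rewrite oppr0.
apply: (mulfI (_ : 2%:R != 0)) => //.
by rewrite -!valX ?oppr_eq0 // sqrrN.
Qed.

Lemma val_prod (I : Type) (r : seq I) (P : pred I) (F : I -> L) :
  (forall i, P i -> F i != 0) ->
  w (\prod_(i <- r | P i) F i) = \sum_(i <- r | P i) w (F i).
Proof.
move=> F0; suff [] : \prod_(i <- r | P i) F i != 0 /\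
  w (\prod_(i <- r | P i) F i) = \sum_(i <- r | P i) w (F i) by [].
elim/big_ind2: _ => [|x a y b [x0 <-] [y0 <-]|i /F0 //].
  by rewrite oner_neq0 val1.
by rewrite mulf_neq0 // valM.
Qed.

Lemma val_int (z : int) : z != 0 -> w z%:~R = (logn p `|z|)%:R.
Proof.
case: vw => _ _ wn; rewrite -absz_gt0 => /wn.
by case: z => n //=; rewrite NegzE mulrNz valN -pmulrn.
Qed.

Lemma val_rat (r : rat) : r != 0 -> w r%:A \is a Num.int.
Proof.
move=> r0; rewrite -[in r%:A](divq_num_den r) -[_%:A]/(in_alg L _).
have n0 : (numq r)%:~R != 0 :> L.
  by rewrite -(rmorph_int (in_alg L)) fmorph_eq0 intr_eq0 numq_eq0.
have d0 : (denq r)%:~R != 0 :> L.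
  by rewrite -(rmorph_int (in_alg L)) fmorph_eq0 intr_eq0 denq_eq0.
rewrite fmorph_div !rmorph_int valM ?invr_eq0 // valV //.
by rewrite !val_int ?numq_eq0 ?denq_eq0 // rpredB // rpred_nat.
Qed.

Lemma val_ge_add c x y : x + y != 0 -> (x == 0) || (c <= w x) ->
  (y == 0) || (c <= w y) -> c <= w (x + y).
Proof. by case: vw => _ wD _ xy0 cx cy; have := wD c x y cx cy; rewrite (negbTE xy0). Qed.

Lemma val_lt_add x y : x != 0 -> (y == 0) || (w x < w y) ->
  x + y != 0 /\ w (x + y) = w x.
Proof.
move=> x0; have [->|y0] /= := eqVneq y 0; first by rewrite addr0.
move=> ltxy; have xy0 : x + y != 0.
  by apply: contraTneq ltxy => /eqP; rewrite addr_eq0 => /eqP ->; rewrite valN ltxx.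
split=> //; apply/eqP; rewrite eq_le val_ge_add ?lexx ?(ltW ltxy) ?orbT // andbT.
rewrite leNgt; apply/negP=> ltxxy.
(* Otherwise [x = (x + y) - y] would have valuation at least [c], which exceeds [w x]. *)
pose c := Num.min (w y) (w (x + y)).
have : c <= w (x + y + - y).
  by apply: val_ge_add; rewrite ?addrK // ?valN /c ge_min lexx ?orbT.
by rewrite addrK leNgt lt_min ltxy ltxxy.
Qed.

Lemma val_lt_sum (I : finType) (F : I -> L) i0 : F i0 != 0 ->
  (forall i, i != i0 -> (F i == 0) || (w (F i0) < w (F i))) ->
  \sum_i F i != 0 /\ w (\sum_i F i) = w (F i0).
Proof.
move=> F0 Fi; rewrite (bigD1 i0) //=; apply: val_lt_add => //.
elim/big_ind: _ => [|x y hx hy|i]; [by rewrite eqxx| |exact: Fi].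
have [//|xy0] /= := eqVneq (x + y) 0.
have [x0|x0] := eqVneq x 0; first by move: hy xy0; rewrite x0 add0r => /orP[->|].
have [y0|y0] := eqVneq y 0; first by move: hx xy0; rewrite y0 addr0 => /orP[->|].
rewrite (negbTE x0) (negbTE y0) /= in hx hy.
apply: (@lt_le_trans _ _ (Num.min (w x) (w y))); first by rewrite lt_min hx hy.
by apply: val_ge_add; rewrite ?ge_min ?lexx ?orbT.
Qed.

End PadicValuation.

(** * Newton polygons and the order of the Galois group *)

(** Passing from [U] to [S] trades [U :\: S] for equally many points outside [U], all of strictly
    larger value. *)
Lemma sum_initial_lt (T : finType) (mu : T -> rat) (U S : {set T}) :
  #|S| = #|U| -> S != U ->
  (forall s u, s \notin U -> u \in U -> mu u < mu s) ->
  \sum_(x in U) mu x < \sum_(x in S) mu x.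
Proof.
move=> cSU nSU ltmu.
rewrite (big_setID S) [ltRHS](big_setID U) /= setIC ltrD2l.
have cD : #|S :\: U| = #|U :\: S| by rewrite !cardsD cSU setIC.
have [u0 Uu0] : exists u, u \in U :\: S.
  apply/set0Pn; rewrite -cards_eq0 -cD cards_eq0 setD_eq0.
  by apply: contra nSU => sSU; rewrite eqEcard sSU cSU leqnn.
pose u1 := [arg max_(u > u0 in U :\: S) mu u]%O.
have [Uu1 maxu1] : u1 \in U :\: S /\ (forall u, u \in U :\: S -> mu u <= mu u1).
  by rewrite /u1; case: Order.TotalTheory.arg_maxP.
apply: (@le_lt_trans _ _ (\sum_(x in U :\: S) mu u1)); first exact: ler_sum.
rewrite sumr_const -cD -sumr_const; apply: ltr_sum.
  have /card_gt0P[s Ss] : (0 < #|S :\: U|)%N by rewrite cD; apply/card_gt0P; exists u0.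
  by apply/hasP; exists s => //; rewrite mem_index_enum.
by move=> s /setDP[_ nUs]; apply: ltmu => //; case/setDP: Uu1.
Qed.

(* A Newton polygon with integral vertices all of whose slopes have a
   denominator divisible by q has a width divisible by q. *)
Lemma dvdn_newton_width (T : finType) (q : nat) (mu : T -> rat) : prime q ->
  (forall U : {set T}, (forall s u, s \notin U -> u \in U -> mu u < mu s) ->
    \sum_(x in U) mu x \is a Num.int) ->
  (forall x, exists N (t : int), [/\ (0 < N)%N, ~~ (q%:Z %| t)%Z
    & mu x = t%:~R / (q * N)%:R]) ->
  (q %| #|T|)%N.
Proof.
move=> q_pr intU denU.
suff H n (U : {set T}) : (#|U| < n)%N ->
    (forall s u, s \notin U -> u \in U -> mu u < mu s) -> (q %| #|U|)%N.
  by rewrite -cardsT; apply: (H #|T|.+1) => [|s u]; rewrite ?inE // cardsT ltnS.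
elim: n U => // n IHn U ltUn initU.
have [->|[u0 Uu0]] := set_0Vmem U; first by rewrite cards0 dvdn0.
pose u1 := [arg max_(u > u0 in U) mu u]%O.
have [Uu1 maxu1] : u1 \in U /\ (forall u, u \in U -> mu u <= mu u1).
  by rewrite /u1; case: Order.TotalTheory.arg_maxP.
(* Dropping the points of largest value leads to the previous vertex: the edge from [V] to [U] has
   slope [mu u1], and its rise is an integer. *)
pose V := [set u in U | mu u < mu u1].
have sVU : V \subset U by apply/subsetP=> u /setIdP[].
have ltVU : (#|V| < #|U|)%N.
  by apply: proper_card; apply/properP; split=> //; exists u1; rewrite ?inE ?ltxx ?andbF.
have initV s u : s \notin V -> u \in V -> mu u < mu s.
  rewrite !inE negb_and => /orP[nUs /andP[Uu _]|]; first exact: initU.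
  by rewrite -leNgt => le1 /andP[_ /lt_le_trans]; apply.
have dvV : (q %| #|V|)%N by apply: IHn => //; apply: leq_trans ltVU _.
have sumE : \sum_(x in U) mu x = \sum_(x in V) mu x + (#|U| - #|V|)%:R * mu u1.
  rewrite (big_setID V) /= (setIidPr sVU); congr (_ + _).
  rewrite -cardsDS // mulr_natl -sumr_const; apply: eq_bigr => u /setDP[Uu].
  by rewrite inE Uu /= -leNgt => le1; apply/eqP; rewrite eq_le maxu1.
have /intrP[z zE] : (#|U| - #|V|)%:R * mu u1 \is a Num.int.
  by rewrite -[X in X \is a _](addKr (\sum_(x in V) mu x)) -sumE addrC rpredB ?intU.
have [N [t [N_gt0 nqt muE]]] := denU u1.
have qN0 : (q * N)%:R != 0 :> rat by rewrite pnatr_eq0 -lt0n muln_gt0 prime_gt0.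
have E : (#|U| - #|V|)%:Z * t = z * (q * N)%:Z.
  apply: (@intr_inj rat); rewrite !intrM -zE muE -!pmulrn.
  by rewrite -mulrA divfK.
have : (q%:Z %| (#|U| - #|V|)%:Z * t)%Z by rewrite E PoszM mulrA mulrAC dvdz_mull.
rewrite Gauss_dvdzl; last first.
  by rewrite coprimezE /= prime_coprime // -dvdzE.
rewrite dvdzE /= => dvUV.
by rewrite -(subnK (ltnW ltVU)) dvdn_add.
Qed.

(** The conjugates of [y] are indexed by group elements, so the width is the group order even if
    some coincide. A vertex is integral because an elementary symmetric function of them is rational
    and has the valuation of its single dominant term. *)
Lemma dvdn_card_gal (L : splittingFieldType rat) (E : {subfield L}) (p q : nat)
    (w : L -> rat) (y : L) :
  padic_valuation p w -> prime q -> galois 1 E -> y \in E -> y != 0 ->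
  (forall s : gal_of E, exists N (t : int), [/\ (0 < N)%N, ~~ (q%:Z %| t)%Z
    & w (s y) = t%:~R / (q * N)%:R]) ->
  (q %| #|'Gal(E / 1)%g|)%N.
Proof.
move=> vw q_pr galE Ey y0 den.
have sy0 (s : gal_of E) : s y != 0 by rewrite fmorph_eq0.
have galT (s : gal_of E) : s \in 'Gal(E / 1)%g.
  by rewrite gal_kHom ?sub1v // k1HomE ahomWin.
have -> : #|'Gal(E / 1)%g| = #|{: gal_of E}|.
  by apply: eq_card => s; rewrite galT inE.
apply: (dvdn_newton_width (mu := fun s : gal_of E => w (s y))) => // U initU.
(* Zero on sets of other sizes, so that the sum of [F] over all sets is the elementary symmetric
   function of degree [#|U|]. *)
pose F (S : {set gal_of E}) := if #|S| == #|U| then \prod_(s in S) s y else 0.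
have F0 (S : {set gal_of E}) : \prod_(s in S) s y != 0.
  by apply/prodf_neq0 => s _; apply: sy0.
have FU : F U = \prod_(s in U) s y by rewrite /F eqxx.
have wprod (S : {set gal_of E}) : w (\prod_(s in S) s y) = \sum_(s in S) w (s y).
  by apply: (val_prod vw) => s _; apply: sy0.
have [|S nSU|e0 we] := val_lt_sum vw (F := F) (i0 := U).
- by rewrite FU.
- rewrite FU /F; case: (#|S| =P #|U|) => [cSU|_]; last by rewrite eqxx.
  by rewrite !wprod sum_initial_lt ?orbT.
rewrite -wprod -FU -we.
suff /vlineP[r eE] : \sum_S F S \in 1%VS by rewrite eE (val_rat vw) // -(fmorph_eq0 (in_alg L)) /= -eE.
have Ee : \sum_S F S \in E.
  apply: rpred_sum => S _; rewrite /F; case: ifP => _; last exact: rpred0.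
  by apply: rpred_prod => s _; apply: memv_gal.
rewrite -(galois_fixedField galE); apply/fixedFieldP => // s _.
(* [s] permutes the terms, translating the index sets on the right. *)
rewrite rmorph_sum [RHS](reindex_inj (can_inj (@rcosetK (gal_of E) s))) /=.
apply: eq_bigr => S _; rewrite /F card_rcoset; case: ifP => _; last exact: rmorph0.
rewrite rmorph_prod [RHS](reindex_inj (mulIg s)) /=.
apply: eq_big => [t|t _]; first by rewrite mem_rcoset mulgK.
by rewrite galM.
Qed.

(** * Galois groups as permutation groups *)

(** By irreducibility [f] is the minimal polynomial of each root, and in characteristic 0 it is
    separable, so its roots are distinct. *)
Lemma splitting_roots (L : splittingFieldType rat) (E : {subfield L})
    (f : {poly rat}) :
  f \is monic -> irreducible_poly f ->
  splittingFieldFor 1 (map_poly (in_alg L) f) E ->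
  galois 1 E /\ exists r : 'I_(size f).-1 -> L,
    [/\ injective r, map_poly (in_alg L) f = \prod_i ('X - (r i)%:P),
        <<1 & codom r>>%VS = E
      & forall i, minPoly 1 (r i) = map_poly (in_alg L) f].
Proof.
move=> fmon [szf irrf] splitf; set fL := map_poly _ f.
have [rs fE rsE] := splitf.
have monL : fL \is monic by rewrite map_monic.
have {}fE : fL = \prod_(z <- rs) ('X - z%:P).
  by apply/eqP; rewrite -eqp_monic // monic_prod_XsubC.
have overL : fL \is a polyOver 1%VS by apply/polyOver1P; exists f.
have minE z : z \in rs -> minPoly 1 z = fL.
  move=> zrs; apply/eqP; rewrite -eqp_monic ?monic_minPoly //.
  have : minPoly 1 z %| fL by apply: minPoly_dvdp; rewrite // fE root_prod_XsubC.
  have [q qE] : exists q, minPoly 1 z = map_poly (in_alg L) q.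
    by apply/polyOver1P; apply: minPolyOver.
  rewrite qE dvdp_map eqp_map; apply: irrf.
  by rewrite -(size_map_poly (in_alg L)) -qE size_minPoly.
have szrs : size rs = (size f).-1.
  by rewrite -(size_map_poly (in_alg L)) -/fL fE size_prod_XsubC.
have sepL : separable_poly fL.
  have rs_gt0 : (0 < size rs)%N by rewrite szrs; case: (size f) szf => [|[]].
  rewrite -(minE _ (mem_nth 0 rs_gt0)); apply: pcharf0_separable => x.
  by rewrite pchar_lalg pchar_num.
have uniq_rs : uniq rs by rewrite -separable_prod_XsubC -fE.
split; first by apply/splitting_galoisField; exists fL.
exists (fun i => rs`_i); have codomE : codom (fun i : 'I_(size f).-1 => rs`_i) = rs.
  apply: (@eq_from_nth _ 0); first by rewrite size_codom card_ord szrs.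
  move=> i; rewrite size_codom card_ord => lti.
  by rewrite (nth_map (Ordinal lti)) ?size_enum_ord // nth_enum_ord.
split.
- move=> i j /eqP; rewrite nth_uniq ?szrs // => /eqP; exact: val_inj.
- by rewrite fE (big_nth 0) big_mkord szrs.
- by rewrite codomE.
- by move=> i; apply: minE; rewrite mem_nth ?szrs.
Qed.

Lemma gal_perm_rep (L : splittingFieldType rat) (E : {subfield L}) (d : nat)
    (r : 'I_d -> L) :
  injective r -> <<1 & codom r>>%VS = E ->
  (forall (s : gal_of E) i, exists j, s (r i) = r j) ->
  exists2 rho : {morphism 'Gal(E / 1)%g >-> 'S_d}, ('injm rho)%g &
    forall s i, r (rho s i) = s (r i).
Proof.
move=> r_inj rE stab.
have Er i : r i \in E by rewrite -rE seqv_sub_adjoin ?codom_f.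
have ex_perm (s : gal_of E) : exists t : 'S_d, [forall i, r (t i) == s (r i)].
  have ex i : exists j, s (r i) == r j by have [j ->] := stab s i; exists j.
  pose h i := xchoose (ex i).
  have hE i : r (h i) = s (r i) by apply/esym/eqP/(xchooseP (ex i)).
  have h_inj : injective h.
    by move=> i j /(congr1 r); rewrite !hE => /fmorph_inj/r_inj.
  by exists (perm h_inj); apply/forallP=> i; rewrite permE hE.
pose rho s := xchoose (ex_perm s).
have rhoE s i : r (rho s i) = s (r i).
  by have /forallP/(_ i)/eqP := xchooseP (ex_perm s).
have rhoM : {in 'Gal(E / 1)%g &, {morph rho : s t / (s * t)%g}}.
  move=> s t _ _; apply/permP=> i; apply: r_inj.
  by rewrite permM !rhoE galM.
exists (Morphism rhoM) => //.
apply/subsetP=> s /morphpreP[Gs /set1P /= rs1].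
apply/set1P/eqP/gal_eqP => z Ez; rewrite gal_id.
have : (<<1 & codom r>> <= fixedField [set s])%VS.
  apply/Fadjoin_seqP; split; first exact: sub1v.
  move=> _ /codomP[i ->]; apply/fixedFieldP => // _ /set1P ->.
  by rewrite -rhoE rs1 perm1.
rewrite rE => /subvP/(_ z Ez)/mem_fixedFieldP[_]; apply; exact: set11.
Qed.

(* The Vandermonde determinant of the roots changes sign under odd
   permutations, so it is rational when the group is alternating. *)
Lemma Vandermonde_Alt_rational (L : splittingFieldType rat) (E : {subfield L})
    (d : nat) (r : 'I_d -> L) (rho : gal_of E -> 'S_d) :
  galois 1 E -> (forall i, r i \in E) ->
  (forall s i, r (rho s i) = s (r i)) ->
  (forall s, s \in 'Gal(E / 1)%g -> ~~ odd_perm (rho s)) ->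
  \prod_(i < d) \prod_(j < d | (i < j)%N) (r j - r i) \in 1%VS.
Proof.
move=> galE Er rhoE even.
pose v := \row_i r i.
have vE : \prod_(i < d) \prod_(j < d | (i < j)%N) (r j - r i) = \det (Vandermonde d v).
  rewrite det_Vandermonde; apply: eq_bigr => i _.
  by apply: eq_bigr => j _; rewrite !mxE.
have Ev : \prod_(i < d) \prod_(j < d | (i < j)%N) (r j - r i) \in E.
  by apply: rpred_prod => i _; apply: rpred_prod => j _; apply: rpredB.
rewrite -(galois_fixedField galE); apply/fixedFieldP => // s Gs.
rewrite vE -det_map_mx.
have -> : map_mx s (Vandermonde d v) = col_perm (rho s) (Vandermonde d v).
  by apply/matrixP=> i j; rewrite !mxE rmorphXn /= rhoE.
by rewrite col_permE det_mulmx det_perm odd_permV (negbTE (even s Gs)) mulr1.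
Qed.

(** * Valuations of the roots *)

Section Trinomial.

Variables (a c : int) (k m n : nat).
Hypotheses (k_gt0 : (0 < k)%N) (m_gt0 : (0 < m)%N) (ltn_km : (n < k * m)%N).

Let size_base (R : idomainType) (x : R) :
  size (('X^k + x%:P) ^+ m) = (k * m).+1.
Proof.
have mon : ('X^k + x%:P) ^+ m \is monic by rewrite monic_exp ?monicXnaddC.
have := size_exp ('X^k + x%:P) m; rewrite size_XnaddC //= => <-.
by rewrite prednK // size_poly_gt0 monic_neq0.
Qed.

Let size_tail (x y : rat) : (size (- (x%:P * 'X^n)) < size (('X^k + y%:P) ^+ m))%N.
Proof.
rewrite size_base size_polyN mul_polyC (leq_ltn_trans (size_scale_leq _ _)) //.
by rewrite size_polyXn ltnS.
Qed.

Lemma fpoly_size : size (fpoly a c k m n) = (k * m).+1.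
Proof. by rewrite /fpoly size_polyDl ?size_base // -(size_base (c%:~R : rat)) size_tail. Qed.

Lemma fpoly_monic : fpoly a c k m n \is monic.
Proof.
rewrite monicE /fpoly lead_coefDl ?size_tail // -monicE.
by rewrite monic_exp ?monicXnaddC.
Qed.

Variable L : fieldExtType rat.

Let fL : {poly L} := map_poly (in_alg L) (fpoly a c k m n).

Lemma fpolyE : fL = ('X^k + (c%:~R)%:P) ^+ m - (a%:~R)%:P * 'X^n.
Proof.
rewrite /fL /fpoly rmorphB rmorphM rmorphXn rmorphD /= !map_polyXn !map_polyC /=.
by rewrite -![_%:A]/(in_alg L _) !rmorph_int.
Qed.

Lemma fpoly_root z : fL.[z] = 0 -> (z ^+ k + c%:~R) ^+ m = a%:~R * z ^+ n.
Proof. by rewrite fpolyE !hornerE => /eqP; rewrite subr_eq0 => /eqP. Qed.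

(** The equation of the root eliminates [a], leaving factors that depend only on
    [z ^+ k + c%:~R]. *)
Lemma fpoly_deriv_root z : fL.[z] = 0 ->
  fL^`().[z] * z = (z ^+ k + c%:~R) ^+ m.-1 *
    ((k * m - n)%:R * (z ^+ k + c%:~R) - (k%:Z * m%:Z * c)%:~R).
Proof.
move=> /fpoly_root zE.
rewrite fpolyE !derivE deriv_exp !derivE !hornerE.
have kz : z ^+ k.-1 * z = z ^+ k by rewrite -exprSr prednK.
have nz : (z ^+ n.-1 *+ n) * z = n%:R * z ^+ n.
  by case: n => [|n']; rewrite ?mulr0n ?mul0r // mulrnAl -exprSr mulr_natl.
have mz : (z ^+ k + c%:~R) ^+ m = (z ^+ k + c%:~R) ^+ m.-1 * (z ^+ k + c%:~R).
  by rewrite -exprSr prednK.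
rewrite !(hornerE, hornerMn, horner_exp) /= mulrBl -[_ * _ * z]mulrA nz mulrCA -zE mz.
rewrite natrB 1?ltnW // natrM !intrM -!pmulrn -kz.
rewrite -[z ^+ k.-1 *+ k]mulr_natl -[(_ * _ * _) *+ m]mulr_natl.
ring.
Qed.

Hypothesis n_gt0 : (0 < n)%N.
Hypothesis a_neq0 : a != 0.
Hypothesis c_neq0 : c != 0.

Let int_neq0 (z : int) : z != 0 -> z%:~R != 0 :> L.
Proof. by move=> z0; rewrite -(rmorph_int (in_alg L)) fmorph_eq0 intr_eq0. Qed.

Lemma fpoly_root_neq0 z : fL.[z] = 0 -> z != 0 /\ z ^+ k + c%:~R != 0.
Proof.
move=> /fpoly_root zE; have z0 : z != 0.
  apply: contra_eq_neq zE => ->.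
  by rewrite !expr0n !gtn_eqF // add0r mulr0 expf_neq0 ?int_neq0.
split=> //; apply: contra_eq_neq zE => ->.
by rewrite expr0n gtn_eqF // eq_sym mulf_neq0 ?expf_neq0 ?int_neq0.
Qed.

Variables (p : nat) (w : L -> rat).
Hypothesis vw : padic_valuation p w.

Lemma fpoly_root_val z : fL.[z] = 0 ->
  m%:R * w (z ^+ k + c%:~R) = (logn p `|a|)%:R + n%:R * w z.
Proof.
move=> fz; have [z0 y0] := fpoly_root_neq0 fz.
rewrite -(valX vw) // (fpoly_root fz) (valM vw) ?expf_neq0 ?int_neq0 //.
by rewrite (val_int vw) // (valX vw).
Qed.

(** If [w z < 0], the power [z ^+ k] dominates and [(k * m - n) * w z] would be the positive
    valuation of [a]; if [w z > 0], then [c] dominates and [0] would be that valuation plus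
    [n * w z]. *)
Lemma fpoly_root_val_tame z : fL.[z] = 0 ->
  logn p `|c| = 0%N -> (0 < logn p `|a|)%N ->
  w z = 0 /\ w (z ^+ k + c%:~R) = (logn p `|a|)%:R / m%:R.
Proof.
move=> fz wc wa; have [z0 y0] := fpoly_root_neq0 fz.
have E := fpoly_root_val fz.
have wcE : w c%:~R = 0 by rewrite (val_int vw) // wc.
have zk0 : z ^+ k != 0 by rewrite expf_neq0.
have wzk : w (z ^+ k) = k%:R * w z by rewrite (valX vw).
have kQ : 0 < k%:R :> rat by rewrite ltr0n.
have mQ : 0 < m%:R :> rat by rewrite ltr0n.
have nQ : 0 < n%:R :> rat by rewrite ltr0n.
have aQ : 0 < (logn p `|a|)%:R :> rat by rewrite ltr0n.
have wz : w z = 0.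
  case: (ltgtP (w z) 0) => // ltz.
    have wy : w (z ^+ k + c%:~R) = k%:R * w z.
      rewrite -wzk; apply: (val_lt_add vw _ _).2 => //.
      by rewrite wcE wzk pmulr_rlt0 ?ltz ?orbT.
    have kmn : n%:R < k%:R * m%:R :> rat by rewrite -natrM ltr_nat.
    by move: E; rewrite wy; nra.
  have wy : w (z ^+ k + c%:~R) = 0.
    rewrite addrC -wcE; apply: (val_lt_add vw _ _).2; first exact: int_neq0.
    by rewrite wcE wzk pmulr_rgt0 ?ltz ?orbT.
  by move: E; rewrite wy; nra.
split=> //; apply: (mulfI (lt0r_neq0 mQ)).
by rewrite E wz mulr0 addr0 mulrC divfK // lt0r_neq0.
Qed.

(** In [fpoly_deriv_root] the last factor is a unit, because [z ^+ k + c%:~R] has positive valuation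
    and [k * m * c] has valuation 0. *)
Lemma fpoly_deriv_val_tame z : fL.[z] = 0 ->
  logn p `|k%:Z * m%:Z * c| = 0%N -> logn p `|c| = 0%N ->
  (0 < logn p `|a|)%N ->
  fL^`().[z] != 0 /\ w fL^`().[z] = (m.-1 * logn p `|a|)%:R / m%:R.
Proof.
move=> fz wkmc wc wa; have [z0 y0] := fpoly_root_neq0 fz.
have [wz wy] := fpoly_root_val_tame fz wc wa.
have dE := fpoly_deriv_root fz.
have kmc0 : k%:Z * m%:Z * c != 0 by rewrite !mulf_neq0 // -lt0n.
have wyp : 0 < w (z ^+ k + c%:~R) by rewrite wy divr_gt0 // ltr0n.
have [u0 wu] : (k * m - n)%:R * (z ^+ k + c%:~R) - (k%:Z * m%:Z * c)%:~R != 0 /\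
    w ((k * m - n)%:R * (z ^+ k + c%:~R) - (k%:Z * m%:Z * c)%:~R) = 0.
  have wk0 : w (- (k%:Z * m%:Z * c)%:~R) = 0 by rewrite (valN vw) (val_int vw) ?wkmc.
  rewrite -wk0 addrC; apply: (val_lt_add vw); first by rewrite oppr_eq0 int_neq0.
  have q0 : (k * m - n)%:R != 0 :> L by rewrite pmulrn int_neq0 // -lt0n subn_gt0.
  rewrite wk0 (valM vw) // pmulrn (val_int vw) -?lt0n ?subn_gt0 //.
  by rewrite ltr_wpDl ?ler0n ?orbT.
have dz0 : fL^`().[z] * z != 0 by rewrite dE mulf_neq0 ?expf_neq0.
have d0 : fL^`().[z] != 0 by move: dz0; rewrite mulf_eq0 negb_or => /andP[].
split=> //; rewrite -[LHS]addr0 -wz -(valM vw) // dE (valM vw) ?expf_neq0 //.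
by rewrite wu addr0 (valX vw) // wy natrM mulrA.
Qed.

(** Where [z ^+ k] dominates, the equation gives [(k * m - n) * w z = 1]. Where [c] dominates, [w z]
    has denominator [n]; at equality it has denominator [k]. *)
Lemma fpoly_root_val_wild z : prime (k * m - n) -> (k < k * m - n)%N ->
  fL.[z] = 0 -> logn p `|a| = 1%N -> (0 < logn p `|c|)%N ->
  if k%:R * w z < (logn p `|c|)%:R then w z = (k * m - n)%:R^-1
  else exists s : int, w z = s%:~R / (n * k)%:R.
Proof.
move=> q_pr ltkq fz wa wc; have [z0 y0] := fpoly_root_neq0 fz.
have E := fpoly_root_val fz; rewrite wa in E.
have wcE : w c%:~R = (logn p `|c|)%:R by rewrite (val_int vw).
have zk0 : z ^+ k != 0 by rewrite expf_neq0.
have wzk : w (z ^+ k) = k%:R * w z by rewrite (valX vw).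
have n0 : n%:R != 0 :> rat by rewrite pnatr_eq0 -lt0n.
have k0 : k%:R != 0 :> rat by rewrite pnatr_eq0 -lt0n.
case: (ltgtP (k%:R * w z) _) => [lt|gt|eq].
- have wy : w (z ^+ k + c%:~R) = k%:R * w z.
    rewrite -wzk; apply: (val_lt_add vw _ _).2 => //.
    by rewrite wcE wzk lt orbT.
  have q0 : (k * m - n)%:R != 0 :> rat by rewrite pnatr_eq0 -lt0n prime_gt0.
  apply: (mulfI q0); rewrite divff // natrB ?(ltnW ltn_km) // natrM.
  by move: E; rewrite wy => E; ring: E.
- have wy : w (z ^+ k + c%:~R) = (logn p `|c|)%:R.
    rewrite addrC -wcE; apply: (val_lt_add vw _ _).2; first exact: int_neq0.
    by rewrite wcE wzk gt orbT.
  exists ((m * logn p `|c|)%:Z * k%:Z - k%:Z).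
  rewrite intrB intrM -!pmulrn !natrM; move: E; rewrite wy => E.
  have -> : w z = (m%:R * (logn p `|c|)%:R - 1) / n%:R by rewrite E; field.
  by field; rewrite n0 k0.
- exists ((logn p `|c|)%:Z * n%:Z); rewrite intrM -!pmulrn natrM -eq.
  by field; rewrite n0 k0.
Qed.

End Trinomial.

(** * The Galois group of the trinomial *)

Section SplittingField.

Variables (a c : int) (k m n : nat) (L : splittingFieldType rat).
Variables (E : {subfield L}) (r : 'I_(k * m) -> L).
Hypotheses (k_gt0 : (0 < k)%N) (m_gt0 : (0 < m)%N) (n_gt0 : (0 < n)%N).
Hypotheses (ltn_km : (n < k * m)%N) (a_neq0 : a != 0) (c_neq0 : c != 0).

Let fL : {poly L} := map_poly (in_alg L) (fpoly a c k m n).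
Hypothesis r_inj : injective r.
Hypothesis fE : fL = \prod_i ('X - (r i)%:P).
Hypothesis Er : forall i, r i \in E.
Hypothesis galE : galois 1 E.

Variable rho : gal_of E -> 'S_(k * m).
Hypothesis rhoE : forall s i, r (rho s i) = s (r i).

Let fr i : fL.[r i] = 0.
Proof. by rewrite fE horner_prod (bigD1 i) //= hornerXsubC subrr mul0r. Qed.

Let r_neq0 i : r i != 0.
Proof. by have [] := fpoly_root_neq0 k_gt0 m_gt0 n_gt0 a_neq0 c_neq0 (fr i). Qed.

Let deriv_r i : fL^`().[r i] = \prod_(j | j != i) (r i - r j).
Proof.
rewrite fE (bigD1 i) //= derivM derivXsubC mul1r !hornerE subrr mul0r addr0.
by rewrite horner_prod; apply: eq_bigr => j _; rewrite hornerXsubC.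
Qed.

Lemma fpoly_odd_gal (l : nat) :
  prime l -> odd (k * m.-1) -> odd (logn l `|a|) ->
  ~~ (l%:Z %| (k * m)%:Z * c)%Z ->
  exists2 s, s \in 'Gal(E / 1)%g & odd_perm (rho s).
Proof.
move=> l_pr odd_k odd_a ndv.
apply/exists_inP; apply: contraT; rewrite negb_exists_in => /forall_inP even.
have [w vw] := ex_padic_valuation L l_pr.
have wkmc : logn l `|k%:Z * m%:Z * c| = 0%N.
  apply/eqP; rewrite lognE; case: ifP => // /and3P[_ _ dv].
  by case/negP: ndv; rewrite PoszM dvdzE.
have wc : logn l `|c| = 0%N.
  apply/eqP; rewrite lognE; case: ifP => // /and3P[_ _ dvc].
  by case/negP: ndv; apply: dvdz_mull; rewrite dvdzE.
have wa : (0 < logn l `|a|)%N by case: (logn l `|a|) odd_a.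
have wd i := fpoly_deriv_val_tame k_gt0 m_gt0 ltn_km n_gt0 a_neq0 c_neq0 vw (fr i) wkmc wc wa.
have rB0 i j : j != i -> r i - r j != 0.
  by move=> nji; rewrite subr_eq0 (inj_eq r_inj) eq_sym.
pose D := \prod_(i < k * m) \prod_(j < k * m | (i < j)%N) (r j - r i).
have D0 : D != 0.
  apply/prodf_neq0 => i _; apply/prodf_neq0 => j ltij.
  by apply: rB0; rewrite neq_ltn ltij.
have /vlineP[x xE] : D \in 1%VS by apply: (Vandermonde_Alt_rational galE Er rhoE).
have /intrP[z zE] : w D \is a Num.int.
  by rewrite xE (val_rat vw) // -(fmorph_eq0 (in_alg L)) /= -xE.
(* Up to sign, each difference of two roots occurs in exactly two of the derivatives. *)
have sumE : \sum_i w fL^`().[r i] = 2%:R * w D.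
  rewrite mulr_natl mulr2n.
  have wD : w D = \sum_(i < k * m) \sum_(j < k * m | (i < j)%N) w (r j - r i).
    rewrite /D (val_prod vw) => [|i _]; last first.
      by apply/prodf_neq0 => j ltij; apply: rB0; rewrite neq_ltn ltij.
    apply: eq_bigr => i _; rewrite (val_prod vw) // => j ltij.
    by apply: rB0; rewrite neq_ltn ltij.
  rewrite {2}wD (exchange_big_dep xpredT) //= wD -big_split /=.
  apply: eq_bigr => i _; rewrite deriv_r (val_prod vw) => [|j]; last exact: rB0.
  rewrite (bigID (fun j : 'I_(k * m) => (i < j)%N)) /=; congr (_ + _).
    apply: eq_big => [j|j _]; first by rewrite neq_ltn orbC andb_orl; case: ltngtP.
    by rewrite -(valN vw) opprB.
  apply: eq_big => [j|//]; rewrite neq_ltn -leqNgt.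
  by case: ltngtP.
have sumE' : \sum_i w fL^`().[r i] = (k * m.-1 * logn l `|a|)%:R.
  under eq_bigr => i _ do rewrite (wd i).2.
  rewrite sumr_const card_ord -mulr_natl !natrM.
  by field; rewrite pnatr_eq0 -lt0n.
have : (k * m.-1 * logn l `|a|)%:Z = 2%:Z * z.
  by apply: (@intr_inj rat); rewrite -pmulrn -sumE' sumE zE intrM.
move/(congr1 absz); rewrite abszM /= => /(congr1 odd).
by rewrite oddM odd_k odd_a oddM.
Qed.

Lemma fpoly_dvdn_gal (p : nat) :
  prime p -> prime (k * m - n) -> (k < k * m - n)%N -> (n.+1 < k * m - n)%N ->
  (k * m < 2 * (k * m - n))%N ->
  logn p `|a| = 1%N -> (0 < logn p `|c|)%N ->
  (k * m - n %| #|'Gal(E / 1)%g|)%N.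
Proof.
set q := (k * m - n)%N => p_pr q_pr ltkq ltnq ltd wa wc.
have [w vw] := ex_padic_valuation L p_pr.
pose g := logn p `|c|.
have n0 : n%:R != 0 :> rat by rewrite pnatr_eq0 -lt0n.
have k0 : k%:R != 0 :> rat by rewrite pnatr_eq0 -lt0n.
have q0 : q%:R != 0 :> rat by rewrite pnatr_eq0 -lt0n prime_gt0.
have co_q x : (0 < x)%N -> (x < q)%N -> coprime q x.
  by move=> x_gt0 ltxq; rewrite prime_coprime // gtnNdvd.
have co_nk : coprime q (n * k) by rewrite coprimeMr !co_q // ltnW.
pose A := [set i | k%:R * w (r i) < g%:R].
have wild i := fpoly_root_val_wild k_gt0 m_gt0 ltn_km n_gt0 a_neq0 c_neq0 vw q_pr ltkq (fr i) wa wc.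
have den (S : {set 'I_(k * m)}) : exists t : int,
    \sum_(i in S) w (r i) = #|S :&: A|%:R / q%:R + t%:~R / (n * k)%:R.
  have [t tE] : exists t : int, \sum_(i in S :\: A) w (r i) = t%:~R / (n * k)%:R.
    elim/big_ind: _ => [|x y [t ->] [u ->]|i].
    - by exists 0; rewrite mul0r.
    - by exists (t + u); rewrite intrD mulrDl.
    - by rewrite !inE => /andP[/negbTE nAi _]; have := wild i; rewrite -/g nAi.
  exists t; rewrite (big_setID A) /= tE; congr (_ + _).
  rewrite mulr_natl -sumr_const; apply: eq_bigr => i.
  by rewrite !inE => /andP[_ Ai]; have := wild i; rewrite -/g Ai.
have sum_r : \sum_i w (r i) = (m * g)%:R.
  have : w fL.[0] = \sum_i w (r i).
    rewrite fE horner_prod (val_prod vw) => [|i _].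
      by apply: eq_bigr => i _; rewrite hornerXsubC sub0r (valN vw).
    by rewrite hornerXsubC sub0r oppr_eq0.
  have c0 : c%:~R != 0 :> L by rewrite -(rmorph_int (in_alg L)) fmorph_eq0 intr_eq0.
  rewrite /fL fpolyE !hornerE !expr0n !gtn_eqF // mulr0 subr0 add0r => <-.
  by rewrite (valX vw) // (val_int vw) // natrM.
(* Without roots of the first kind, each [z ^+ k + c%:~R] has valuation at least [g]. Summing
   [fpoly_root_val] over the roots then gives [q * g <= k], against [k < q]. *)
have [i0 Ai0] : exists i, i \in A.
  apply/set0Pn; apply: contraL ltkq => /eqP A0; rewrite -leqNgt.
  have wy i : g%:R <= w (r i ^+ k + c%:~R).
    have [_ y0] := fpoly_root_neq0 k_gt0 m_gt0 n_gt0 a_neq0 c_neq0 (fr i).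
    apply: (val_ge_add vw y0); last by rewrite (val_int vw) // lexx orbT.
    rewrite (valX vw) //; apply/orP; right.
    by have := in_set0 i; rewrite -A0 inE => /negbT; rewrite -leNgt.
  have : \sum_(i < k * m) m%:R * g%:R <= \sum_i m%:R * w (r i ^+ k + c%:~R).
    by apply: ler_sum => i _; rewrite ler_wpM2l.
  under [X in _ <= X]eq_bigr => i _ do
    rewrite (fpoly_root_val k_gt0 m_gt0 n_gt0 a_neq0 c_neq0 vw (fr i)) wa.
  rewrite big_split /= -[X in _ + X]mulr_sumr sum_r !sumr_const card_ord.
  rewrite -[(_ * _) *+ (k * m)]mulr_natl -!natrM -natrD ler_nat => le1.
  have le2 : (m * (q * g) <= m * k)%N.
    have kmE : (k * m = q + n)%N by rewrite subnK // ltnW.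
    by move: le1; rewrite {1}kmE; clear; nia.
  rewrite leq_pmul2l // in le2; apply: leq_trans le2.
  by rewrite leq_pmulr.
(* The total valuation [m * g] is an integer and [n * k] is prime to [q], so [#|A| / q] has no [q]
   left in its denominator. *)
have dvA : (q %| #|A|)%N.
  have [t tE] := den [set: 'I_(k * m)].
  rewrite setTI big_mkcond /= in tE.
  have {}tE : (#|A| * (n * k))%:Z = q%:Z * ((m * g * (n * k))%:Z - t).
    apply: (@intr_inj rat); rewrite intrM intrB -!pmulrn.
    have -> : (m * g * (n * k))%:R = (\sum_i w (r i)) * (n * k)%:R :> rat by rewrite sum_r -natrM.
    have -> : \sum_i w (r i) = #|A|%:R / q%:R + t%:~R / (n * k)%:R.
      by rewrite -tE; apply: eq_bigr => i _; rewrite inE.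
    by rewrite !natrM; field; rewrite n0 k0 q0.
  rewrite -(Gauss_dvdl _ co_nk); have : (q%:Z %| (#|A| * (n * k))%:Z)%Z by rewrite tE dvdz_mulr.
  by rewrite dvdzE.
have cardA : (q <= #|A|)%N by apply: dvdn_leq dvA; apply/card_gt0P; exists i0.
have [M /eqP cM] : exists M : {set 'I_(k * m)}, #|M| == n.+1.
  have : (0 < #|[set M : {set 'I_(k * m)} | #|M| == n.+1]|)%N.
    by rewrite card_draws card_ord bin_gt0.
  by case/card_gt0P=> M; rewrite inE; exists M.
apply: (dvdn_card_gal (y := \prod_(i in M) r i) vw) => //.
- by apply: rpred_prod => i _; apply: Er.
- by apply/prodf_neq0 => i _; apply: r_neq0.
move=> s; pose M' := [set rho s i | i in M].
have cM' : #|M'| = n.+1 by rewrite card_imset //; apply: perm_inj.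
have [t tE] := den M'.
(* At most [n] roots lie outside [A], so [n.+1] roots cannot avoid it; and [n.+1 < q]. *)
have bM : (0 < #|M' :&: A| < q)%N.
  apply/andP; split; last by rewrite (leq_ltn_trans (subset_leq_card (subsetIl _ _))) ?cM'.
  rewrite lt0n; apply/negP=> /eqP I0.
  have cU : #|M' :|: A| = (n.+1 + #|A|)%N by rewrite -cM' -cardsUI I0 addn0.
  have : (#|M' :|: A| <= k * m)%N by rewrite -[leqRHS]card_ord max_card.
  by rewrite cU leqNgt addSn ltnS -leq_subLR cardA.
case/andP: bM => b_gt0 ltbq.
(* This is the numerator over [q * (n * k)]; modulo [q] it is [#|M' :&: A| * (n * k)], both factors
   being prime to [q]. *)
exists (n * k)%N, (#|M' :&: A|%:Z * (n * k)%:Z + q%:Z * t); split.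
- by rewrite muln_gt0 n_gt0.
- rewrite rpredDr; last by rewrite dvdz_mulr.
  rewrite -PoszM dvdzE /= Gauss_dvdl //.
  by rewrite gtnNdvd.
- have -> : w (s (\prod_(i in M) r i)) = \sum_(i in M') w (r i).
    rewrite rmorph_prod (val_prod vw) => [|i _]; last by rewrite fmorph_eq0 r_neq0.
    rewrite big_imset /=; last by move=> i j _ _; apply: perm_inj.
    by apply: eq_bigr => i _; rewrite rhoE.
  rewrite tE intrD !intrM -!pmulrn !natrM; field.
  by rewrite n0 k0 q0.
Qed.

End SplittingField.

Theorem mainTheorem9 (a c : int) (k m n : nat) :
  (n < k * m)%N ->
  irreducible_poly (fpoly a c k m n) ->
  prime (k * m - n) ->
  (k * m < 2 * (k * m - n))%N -> ((k * m - n) + 2 < k * m)%N ->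
  (exists p : nat, [/\ prime p, (p%:Z %| c)%Z, (p%:Z %| a)%Z & ~~ ((p ^ 2)%:Z %| a)%Z]) ->
  odd (k * (m - 1)) ->
  (exists l : nat, [/\ prime l, odd (logn l `|a|%N) & ~~ (l%:Z %| (k * m)%:Z * c)%Z]) ->
  forall (L : splittingFieldType rat) (E : {subfield L}),
    splittingFieldFor 1%VS (map_poly (in_alg L) (fpoly a c k m n)) E ->
    ('Gal(E / 1%VS) \isog [set: 'S_(k * m)])%g.
Proof.
move=> ltn_km irr q_pr ltd2q ltqd [p [p_pr pc pa np2a]] odd_k [l [l_pr odd_a ndv]] L E splitE.
rewrite subn1 in odd_k.
have [k_odd m1_odd] : odd k /\ odd m.-1 by apply/andP; rewrite -oddM.
have k_gt0 : (0 < k)%N by case: (k) k_odd.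
have m_gt1 : (1 < m)%N by case: (m) m1_odd => [|[]].
have m_gt0 := ltnW m_gt1.
have n_gt0 : (0 < n)%N by move: ltqd; case: (n) => //; rewrite subn0 addn2 ltnNge ltnW // ltnW.
have a_neq0 : a != 0 by apply: contraTneq odd_a => ->; rewrite logn0.
have c_neq0 : c != 0 by apply: contraNneq ndv => ->; rewrite mulr0 dvdz0.
set q := (k * m - n)%N in q_pr ltd2q ltqd.
have kmE : (k * m = q + n)%N by rewrite subnK // ltnW.
(* As [m >= 2], one has [2 * k <= k * m < 2 * q]. *)
have ltkq : (k < q)%N.
  rewrite -(ltn_pmul2l (isT : 0 < 2)%N) (leq_ltn_trans _ ltd2q) //.
  by rewrite mulnC leq_pmul2l.
have ltnq : (n < q)%N by move: ltd2q; rewrite kmE mul2n -addnn ltn_add2l.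
have q_odd : odd q.
  have n_gt2 : (2 < n)%N by move: ltqd; rewrite kmE ltn_add2l.
  by case: (even_prime q_pr) (ltn_trans n_gt2 ltnq) => // ->.
(* k m is even and q is odd, so n is odd. *)
have ltSnq : (n.+1 < q)%N.
  rewrite ltn_neqAle ltnq andbT; apply/eqP=> nq.
  have : odd (k * m) = false.
    by rewrite oddM -(prednK m_gt0) oddS m1_odd andbF.
  by rewrite kmE oddD; move: q_odd; rewrite -nq /=; case: (odd n).
have [galE] := splitting_roots (fpoly_monic a c k_gt0 ltn_km) irr splitE.
rewrite fpoly_size //= => -[r [r_inj fE rE minE]].
have Er i : r i \in E by rewrite -rE seqv_sub_adjoin ?codom_f.
have stab (s : gal_of E) i : exists j, s (r i) = r j.
  have : root (map_poly (in_alg L) (fpoly a c k m n)) (s (r i)).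
    have Gs : s \in 'Gal(E / 1)%g by rewrite gal_kHom ?sub1v // k1HomE ahomWin.
    by rewrite -(minE i) (root_minPoly_gal (sub1v E) Gs (Er i)).
  rewrite fE rootE horner_prod => /prodf_eq0[j _].
  by rewrite hornerXsubC subr_eq0 => /eqP; exists j.
have [rho rho_inj rhoE] := gal_perm_rep r_inj rE stab.
have cardGal : #|rho @* 'Gal(E / 1)|%g = #|'Gal(E / 1)%g| by rewrite card_injm.
suff <- : (rho @* 'Gal(E / 1))%g = [set: 'S_(k * m)] by apply: sub_isog.
apply: (@trans_prime_odd_Sym _ q _) => //=.
- by rewrite card_ord ltqd.
- have d_gt0 : (0 < k * m)%N by rewrite muln_gt0 k_gt0.
  apply/imsetP; exists (Ordinal d_gt0) => //; apply/esym/setP=> j.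
  rewrite inE; apply/orbitP.
  (* Transitivity: all roots share the minimal polynomial [f], so they are conjugate. *)
  have rj : root (minPoly 1 (r (Ordinal d_gt0))) (r j).
    by rewrite minE -(minE j) root_minPoly.
  have [_ _ normE] := and3P galE.
  have [x Gx xE] := normalField_root_minPoly (sub1v E) normE (Er _) rj.
  exists (rho x); first exact: mem_morphim.
  by apply: r_inj; rewrite -xE -rhoE.
- rewrite cardGal; apply: (fpoly_dvdn_gal k_gt0 m_gt0 n_gt0 ltn_km a_neq0 c_neq0 fE Er galE rhoE p_pr) => //.
  + apply/eqP; rewrite eqn_leq leqNgt -!pfactor_dvdn ?absz_gt0 // expn1.
    by move: pa np2a; rewrite !dvdzE /= => -> ->.
  + by rewrite -pfactor_dvdn ?absz_gt0 // expn1; move: pc; rewrite dvdzE.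
have [s Gs odd_s] := fpoly_odd_gal k_gt0 m_gt0 n_gt0 ltn_km a_neq0 c_neq0 r_inj fE Er galE rhoE l_pr odd_k odd_a ndv.
apply/subsetPn; exists (rho s); first exact: mem_morphim.
by rewrite Alt_even odd_s.
Qed.
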